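(* Let $Y=\mathbb R^2$ and $S=\{(\tfrac1n,0):n\in\mathbb N^*\cup\{\infty\}\}$ (with $\tfrac1\infty=0$). The fiber above $(0,0)$ in the universal covering $\widetilde Y^S\to Y$ of $Y$ possibly branched over $S$ is homeomorphic to $\mathbb Z^{\mathbb N}$ endowed with the weak (product) topology; hence it is not locally compact.
   Context: A subset $D$ of a space $X$ is locally connected in $X$ if $U\cap D$ is connected for every open connected $U\subset X$. A spread $p:X\to Y$ is a continuous map (between Hausdorff, locally path connected, first countable spaces) such that the connected components of preimages $p^{-1}(U)$ of open subsets $U\subset Y$ generate the topology of $X$. It is complete if for every $y\in\overline{p(X)}$ and every inclusion-increasing assignment $\chi$ associating to each open connected neighborhood $U$ of $y$ a connected component $\chi(U)$ of $p^{-1}(U)$, one has $\bigcap_U\chi(U)\neq\emptyset$. A completion of a spread $X\to Y$ is a complete spread $X'\to Y$ with an embedding $X\to X'$ over $Y$ whose image is open, dense and locally connected in $X'$; every spread has a completion, unique up to isomorphism. The universal covering $\widetilde Y^S\to Y$ possibly branched over $S$ is the completion of the spread $\widetilde{Y\setminus S}\to Y$, where $\widetilde{Y\setminus S}$ is the universal covering of $Y\setminus S$. In $\mathbb Z^{\mathbb N}$, each factor $\mathbb Z$ is discrete. *)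

(* Defs.v *)
From HB Require Import structures.
From mathcomp Require Import all_boot all_order all_algebra.
From mathcomp Require Import all_classical all_reals all_analysis.

Set Implicit Arguments.
Unset Strict Implicit.
Unset Printing Implicit Defensive.

Import Order.TTheory GRing.Theory Num.Theory.
Import numFieldNormedType.Exports.

Local Open Scope classical_set_scope.
Local Open Scope ring_scope.

Definition homeomorphic (X Y : topologicalType) : Prop :=
  exists (f : X -> Y) (g : Y -> X),
    [/\ cancel f g, cancel g f, continuous f & continuous g].

(* Injective, and a homeomorphism onto the image: the topology of X is the one
   induced by i. *)
Definition embedding (X Y : topologicalType) (i : X -> Y) : Prop :=
  injective i /\
  forall U : set X, open U <-> exists2 V : set Y, open V & U = i @^-1` V.

Definition first_countable (X : topologicalType) : Prop :=
  forall x : X, exists B : set (set X),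
    [/\ countable B, B `<=` nbhs x &
        forall U, nbhs x U -> exists2 V, B V & V `<=` U].

(* The topology of X is the one generated by G: G is a subbase. *)
Definition generates_topology (X : topologicalType) (G : set (set X)) : Prop :=
  forall U : set X, open U <->
    exists2 D : set (set X),
      D `<=` finI_from G id & U = \bigcup_(V in D) V.

(* As [connected set0] holds, no nonemptiness condition on U or U `&` D is
   imposed. *)
Definition locally_connected_in (X : topologicalType) (D : set X) : Prop :=
  forall U : set X, open U -> connected U -> connected (U `&` D).

(* A path is a function on R, of which only the restriction to [0, 1] matters;
   similarly homotopies are functions on R * R restricted to [0, 1]^2. *)
Definition is_path (R : realType) (X : topologicalType) (A : set X) (x y : X)
    (c : R -> X) : Prop :=
  [/\ {within `[0, 1], continuous c}, c 0 = x, c 1 = y &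
      forall t : R, 0 <= t <= 1 -> A (c t)].

Definition path_connected (R : realType) (X : topologicalType) (A : set X) :
    Prop :=
  forall x y, A x -> A y -> exists c : R -> X, is_path A x y c.

Definition locally_path_connected (R : realType) (X : topologicalType) : Prop :=
  forall (x : X) (U : set X), nbhs x U ->
    exists V : set X, [/\ open V, V x, V `<=` U & path_connected R V].

Definition null_homotopic (R : realType) (X : topologicalType) (x : X)
    (c : R -> X) : Prop :=
  exists H : R * R -> X,
    [/\ {within `[0, 1]%classic `*` `[0, 1]%classic, continuous H},
        forall t : R, 0 <= t <= 1 -> H (0, t) = c t,
        forall t : R, 0 <= t <= 1 -> H (1, t) = x &
        forall s : R, 0 <= s <= 1 -> H (s, 0) = x /\ H (s, 1) = x].

Definition simply_connected (R : realType) (X : topologicalType) : Prop :=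
  path_connected R [set: X] /\
  forall (x : X) (c : R -> X), is_path [set: X] x x c -> null_homotopic x c.

Definition evenly_covered (E B : topologicalType) (q : E -> B) (U : set B) :
    Prop :=
  exists F : set (set E),
    [/\ trivIset F id, \bigcup_(V in F) V = q @^-1` U &
        forall V, F V ->
          [/\ open V, set_inj V q, q @` V = U &
              forall W, open W -> W `<=` V -> open (q @` W)]].

Definition is_covering (E B : topologicalType) (q : E -> B) : Prop :=
  [/\ continuous q, range q = [set: B] &
      forall b : B, exists U : set B, [/\ open U, U b & evenly_covered q U]].

Definition is_universal_covering (R : realType) (E B : topologicalType)
    (q : E -> B) : Prop :=
  is_covering q /\ simply_connected R E.

(* The set of connected components of A is [connected_component A @` A]. *)
Definition is_spread (R : realType) (X Y : topologicalType) (p : X -> Y) :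
    Prop :=
  [/\ hausdorff_space X /\ hausdorff_space Y,
      locally_path_connected R X /\ locally_path_connected R Y,
      first_countable X /\ first_countable Y,
      continuous p &
      generates_topology
        (\bigcup_(U in [set U : set Y | open U])
           (connected_component (p @^-1` U) @` (p @^-1` U)))].

Definition open_connected_nbhs (Y : topologicalType) (y : Y) : set (set Y) :=
  [set U | [/\ open U, connected U & U y]].

(* Only the values of chi on [open_connected_nbhs y] matter. *)
Definition is_complete (X Y : topologicalType) (p : X -> Y) : Prop :=
  forall y : Y, closure (range p) y ->
  forall chi : set Y -> set X,
    (forall U, open_connected_nbhs y U ->
       (connected_component (p @^-1` U) @` (p @^-1` U)) (chi U)) ->
    (forall U V, open_connected_nbhs y U -> open_connected_nbhs y V ->
       U `<=` V -> chi U `<=` chi V) ->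
    \bigcap_(U in open_connected_nbhs y) chi U !=set0.

Definition is_completion (R : realType) (X X' Y : topologicalType)
    (p : X -> Y) (p' : X' -> Y) (i : X -> X') : Prop :=
  [/\ is_spread R p,
      is_spread R p' /\ is_complete p',
      embedding i /\ p' \o i = p &
      [/\ open (range i), dense (range i) & locally_connected_in (range i)]].

(* p : X -> Y is (a model of) the universal covering of Y possibly branched
   over S, which is only determined up to isomorphism. *)
Definition is_branched_universal_covering (R : realType) (Y : topologicalType)
    (S : set Y) (X : topologicalType) (p : X -> Y) : Prop :=
  exists (E : topologicalType) (q : E -> ~` S) (i : E -> X),
    is_universal_covering R q /\ is_completion R (set_val \o q) p i.

Definition harmonic_points (R : realType) : set (R * R) :=
  [set (n%:R^-1, 0) | n in [set n : nat | (0 < n)%N]] `|` [set (0, 0)].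

Arguments harmonic_points R : clear implicits.

(* Main.v *)
Require Import Defs.
From mathcomp Require Import all_boot all_order all_algebra.
From mathcomp Require Import all_classical all_reals all_analysis.
From mathcomp Require Import ring lra.
Import Order.TTheory GRing.Theory Num.Theory.
Import numFieldNormedType.Exports.
Set Implicit Arguments.
Unset Strict Implicit.
Unset Printing Implicit Defensive.
Local Open Scope classical_set_scope.
Local Open Scope ring_scope.

(** Let U_n be the plane for n = 0 and the open square of half-side 1/n centred
    at the origin for n > 0. A point x of the fiber above (0, 0) is determined by
    the decreasing sequence of the components of p^-1(U_n) that contain it: these
    components form a neighbourhood basis of x, because every open set of X is
    generated by components of preimages ([level_comp_basis]), and X is Hausdorff.
    Conversely completeness turns every decreasing sequence of components into a
    point of the fiber ([thread_point]). The fiber is thus the space of branches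
    of the tree of these components, whose root is X itself. If every vertex of
    that tree has countably infinitely many children, then numbering the children
    of each vertex by the integers identifies the space of branches, with its
    topology, with the product of copies of Z. No compact set can then contain a
    neighbourhood of a point, for some coordinate takes all integer values on it.

    That there are at most countably many children is the Poincare-Volterra
    theorem: a connected covering E of a second countable space is a countable
    union of sheets, so that a disjoint family of nonempty open sets of E is
    countable ([covering_countable_open_family]).

    That there are infinitely many comes from winding around the branch point
    s = (1/(n+1), 0), which lies in U_n but not in U_(n+1) ([level_comp_children]).
    As E is simply connected, the direction from q(e) to s has a continuous angle
    theta on E ([global_angle]). Inside a component of p^-1(U_n), follow lifts of
    a small circle around s: theta takes there all the values 2 k pi at points
    above one and the same point of U_(n+1). Two of these points cannot be in the
    same component of p^-1(U_(n+1)), since theta would take on it some value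
    2 k pi + pi, while U_(n+1) lies entirely on the left of s. *)

(** * Paths and connectedness *)

Lemma continuousT_comp (T U V : topologicalType) (f : T -> U) (g : U -> V) :
  continuous f -> continuous g -> continuous (g \o f).
Proof. by move=> cf cg t; apply: continuous_comp; [exact: cf|exact: cg]. Qed.

Lemma continuous_within_comp (T U V : topologicalType) (A : set U)
    (f : T -> U) (g : U -> V) :
  continuous f -> range f `<=` A -> {within A, continuous g} ->
  continuous (g \o f).
Proof.
move=> cf fA /subspace_continuousP cg t.
have Aft : A (f t) by apply: fA; exists t.
move=> W /= /(cg _ Aft) fW.
have /cf : nbhs (f t) (fun x => A x -> W (g x)) by exact: fW.
rewrite !nbhs_simpl /= => h; apply: (filterS _ h) => x /=; apply; apply: fA; by exists x.
Qed.

(** Retraction of the line onto [0, 1]: composing with it turns a path, which is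
    continuous on [0, 1] only, into a map that is continuous everywhere. *)
Definition clamp {R : realType} (t : R) : R := Num.max 0 (Num.min 1 t).

Lemma clamp_itv {R : realType} (t : R) : 0 <= clamp t <= 1.
Proof. by rewrite /clamp le_max lexx /= ge_max ler01 /= ge_min lexx. Qed.

Lemma clamp_id {R : realType} (t : R) : 0 <= t <= 1 -> clamp t = t.
Proof. by move=> /andP[t0 t1]; rewrite /clamp min_r// max_r. Qed.

Lemma continuous_clamp {R : realType} : continuous (@clamp R).
Proof.
move=> t; apply: (@continuous_max R R (fun=> 0) (fun t => Num.min 1 t) t).
  exact: cvg_cst.
by apply: (@continuous_min R R (fun=> 1) id t); [exact: cvg_cst|exact: cvg_id].
Qed.

Lemma path_clamp (R : realType) (X : topologicalType) (A : set X) x y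
    (c : R -> X) : is_path A x y c ->
  [/\ continuous (c \o clamp), (c \o clamp) 0 = x, (c \o clamp) 1 = y &
      forall t, A ((c \o clamp) t)].
Proof.
move=> [cc c0 c1 cA]; split.
- apply: continuous_within_comp cc; first exact: continuous_clamp.
  by move=> _ [t _ <-]; rewrite /= in_itv /=; exact: clamp_itv.
- by rewrite /= clamp_id ?lexx ?ler01.
- by rewrite /= clamp_id ?lexx ?ler01.
- by move=> t; apply: cA; exact: clamp_itv.
Qed.

Lemma is_pathW (R : realType) (X : topologicalType) (A : set X)
    (c : R -> X) : continuous c -> (forall t, 0 <= t <= 1 -> A (c t)) ->
  is_path A (c 0) (c 1) c.
Proof. by move=> cc cA; split=> //; exact: continuous_subspaceT. Qed.

Lemma path_rev (R : realType) (X : topologicalType) (A : set X) x y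
    (c : R -> X) : is_path A x y c -> exists c' : R -> X, is_path A y x c'.
Proof.
move=> /path_clamp[cc c0 c1 cA]; exists (c \o clamp \o (fun t => 1 - t)).
rewrite -c0 -c1.
have -> : (c \o clamp) 0 = (c \o clamp \o (fun t => 1 - t)) 1.
  by rewrite /= subrr.
have -> : (c \o clamp) 1 = (c \o clamp \o (fun t => 1 - t)) 0.
  by rewrite /= subr0.
apply: is_pathW => [t|t _]; last exact: cA.
by apply: continuous_comp; [apply: cvgB; [exact: cvg_cst|exact: cvg_id]|exact: cc].
Qed.

Lemma path_cat (R : realType) (X : topologicalType) (A : set X) x y z
    (c d : R -> X) : is_path A x y c -> is_path A y z d ->
  exists c' : R -> X, is_path A x z c'.
Proof.
move=> /path_clamp[cc c0 c1 cA] /path_clamp[dc d0 d1 dA].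
pose e t := if t <= 2^-1 then (c \o clamp) (2 * t) else (d \o clamp) (2 * t - 1).
have cmul (b : R) : continuous (fun t : R => 2 * t - b).
  move=> t; apply: cvgB; last exact: cvg_cst.
  by apply: cvgM; [exact: cvg_cst|exact: cvg_id].
exists e; split.
- apply: continuous_subspaceT.
  apply/continuous_subspace_setT.
  have -> : [set: R] = [set t | t <= 2^-1] `|` [set t | 2^-1 <= t].
    by rewrite eqEsubset; split=> // t _ /=; case: (leP t 2^-1) => [|/ltW]; [left|right].
  apply: withinU_continuous; [exact: closed_le|exact: closed_ge| |].
  + apply: (@subspace_eq_continuous R [set t | t <= 2^-1] X
      (fun t : R => (c \o clamp) (2 * t - 0)) e).
      by move=> t /set_mem /= t2; rewrite /from_subspace/= /e t2 subr0.
    by apply: continuous_subspaceT; exact: (continuousT_comp (cmul 0) cc).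
  + apply: (@subspace_eq_continuous R [set t | 2^-1 <= t] X
      (fun t : R => (d \o clamp) (2 * t - 1)) e).
      move=> t /set_mem /= t2; rewrite /from_subspace/= /e; case: ifP => // t2'.
      have -> : t = 2^-1 by apply/eqP; rewrite eq_le t2 t2'.
      by rewrite divff// subrr; rewrite -/((d \o clamp) 0) d0 -c1.
    by apply: continuous_subspaceT; exact: (continuousT_comp (cmul 1) dc).
- by rewrite /e invr_ge0 ler0n mulr0.
- rewrite /e ifF; first by rewrite -d1 mulr1; congr ((d \o clamp) _); ring.
  by apply/negbTE; rewrite -ltNge; lra.
- by move=> t _; rewrite /e; case: ifP => _; [exact: cA|exact: dA].
Qed.

Lemma connected_image (T U : topologicalType) (A : set T) (f : T -> U) :
  continuous f -> connected A -> connected (f @` A).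
Proof.
by move=> cf cA; apply: connected_continuous_connected => //; exact: continuous_subspaceT.
Qed.

Lemma connectedR (R : realType) : connected [set: R].
Proof. by apply/connected_intervalP. Qed.

Lemma star_connected (T : topologicalType) (A : set T) :
  (forall x y, A x -> A y -> exists C, [/\ C x, C y, C `<=` A & connected C]) ->
  connected A.
Proof.
move=> hA; have [->|/set0P[x Ax]] := eqVneq A set0; first exact: connected0.
suff -> : A = connected_component A x by exact: component_connected.
rewrite eqEsubset; split; last exact: connected_component_sub.
by move=> y Ay; have [C [Cx Cy CA cC]] := hA _ _ Ax Ay; exists C.
Qed.

Lemma path_connected_connected (R : realType) (X : topologicalType)
    (A : set X) : path_connected R A -> connected A.
Proof.
move=> pA; apply: star_connected => x y Ax Ay.
have [c /path_clamp[cc c0 c1 cA]] := pA _ _ Ax Ay.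
exists (range (c \o clamp)); split.
- by exists 0.
- by exists 1.
- by move=> _ [t _ <-]; exact: cA.
- by apply: connected_image => //; exact: connectedR.
Qed.

Lemma open_component (R : realType) (X : topologicalType) (A : set X) x :
  locally_path_connected R X -> open A -> open (connected_component A x).
Proof.
move=> lX oA; rewrite openE => y xy; have Ay := connected_component_sub xy.
have [V [oV Vy VA pV]] := lX y A (open_nbhs_nbhs (conj oA Ay)).
rewrite (same_connected_component xy) /interior.
apply: filterS (open_nbhs_nbhs (conj oV Vy)).
by apply: connected_component_max => //; exact: path_connected_connected pV.
Qed.

Lemma fst_continuous (T U : topologicalType) : continuous (@fst T U).
Proof. by move=> x; exact: cvg_fst. Qed.

Lemma snd_continuous (T U : topologicalType) : continuous (@snd T U).
Proof. by move=> x; exact: cvg_snd. Qed.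

Lemma pair_continuous (T U V : topologicalType) (f : T -> U) (g : T -> V) :
  continuous f -> continuous g -> continuous (fun x => (f x, g x)).
Proof. by move=> cf cg x; apply: cvg_pair; [exact: cf|exact: cg]. Qed.


(** * Angles of nonvanishing plane-valued maps *)

Section Angle.
Variable R : realType.
Implicit Types (z w : R * R) (s t : R).

Definition is_angle z t := exists2 r : R, 0 < r & z = (r * cos t, r * sin t).
Definition dot z w := z.1 * w.1 + z.2 * w.2.
Definition cross z w := z.1 * w.2 - z.2 * w.1.

Lemma is_angle_cosB z s t : is_angle z s -> is_angle z t -> cos (s - t) = 1.
Proof.
move=> [r r0 ->] [r' r'0 [cE sE]].
have rr : r = r'.
  apply/eqP; rewrite -(eqrXn2 (n := 2))// ?ltW//.
  by rewrite -[_ ^+ 2]mulr1 -[_ ^+ 2 in X in _ == X]mulr1 -{1}(cos2Dsin2 s)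
     -(cos2Dsin2 t) !mulrDr -!exprMn cE sE.
rewrite {}rr in cE sE.
have r0' : r' != 0 by rewrite gt_eqF.
by rewrite cosB (mulfI r0' cE) (mulfI r0' sE) -!expr2 cos2Dsin2.
Qed.

Lemma cos_eq1_small t : `|t| <= pi -> cos t = 1 -> t = 0.
Proof.
move=> tpi; rewrite -cos_norm -cos0 => /cos_inj h.
by apply/eqP; rewrite -normr_eq0 h// in_itv/= ?lexx ?pi_ge0 ?normr_ge0.
Qed.

(** The zeros of 1 - cos are isolated. In the uses below, f is the difference of
    two angles of the same vector, so this is the uniqueness of continuous lifts
    of the angle. *)
Lemma connected_cos_eq1 (T : topologicalType) (D : set T) (f : T -> R) x y :
  connected D -> continuous f -> (forall x, D x -> cos (f x) = 1) ->
  D x -> D y -> f x = f y.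
Proof.
move=> cD cf f1; wlog: x y / f x <= f y.
  by move=> wl Dx Dy; case: (leP (f x) (f y)) => [|/ltW] h; [|symmetry]; exact: wl.
rewrite le_eqVlt => /predU1P[//|xy] Dx Dy.
have /connected_intervalP itv := connected_image cf cD.
(* f takes the value m, which is too close to f x to be another zero *)
pose m := Num.min (f x + pi) (f y).
have xm : f x < m by rewrite lt_min ltrDl pi_gt0 xy.
have [z Dz fz] : (f @` D) m.
  apply: (itv (f x) (f y)); [by exists x|by exists y|].
  by rewrite (ltW xm) ge_min lexx orbT.
have s0 : sin (f x) = 0 by apply: cos1sin0; rewrite f1// normr1.
have mx : cos (m - f x) = 1 by rewrite cosB s0 mulr0 addr0 -fz !f1// mulr1.
have /cos_eq1_small : `|m - f x| <= pi.
  by rewrite gtr0_norm ?subr_gt0// lerBlDl ge_min lexx.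
by move=> /(_ mx)/eqP; rewrite subr_eq0 gt_eqF.
Qed.

(** The angle from z to w is less than a right angle, and its tangent is the
    quotient of the cross and dot products. This formula is continuous in z and
    w, which makes local lifts of angles explicit. *)
Lemma is_angle_step z w t : 0 < dot z w -> is_angle z t ->
  is_angle w (t + atan (cross z w / dot z w)).
Proof.
set a := atan _; move=> d0 [r r0 zE].
have ca : 0 < cos a by apply: cos_gt0_pihalf; rewrite atan_gtNpi2 atan_ltpi2.
have sa : sin a = cos a * (cross z w / dot z w).
  by rewrite -(atanK (cross z w / dot z w)) -/a /tan mulrC divfK// gt_eqF.
have {sa ca}[ca sa] := (conj ca sa); exists (dot z w / (r * cos a)).
  by rewrite divr_gt0// mulr_gt0.
have r2 : z.1 ^+ 2 + z.2 ^+ 2 = r ^+ 2.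
  by rewrite zE !exprMn -mulrDr cos2Dsin2 mulr1.
have dn : dot z w != 0 by rewrite gt_eqF.
have rn : r != 0 by rewrite gt_eqF.
have cn : cos a != 0 by rewrite gt_eqF.
have w1 : r ^+ 2 * w.1 = dot z w * z.1 - cross z w * z.2.
  by rewrite -r2 /dot /cross; ring.
have w2 : r ^+ 2 * w.2 = dot z w * z.2 + cross z w * z.1.
  by rewrite -r2 /dot /cross; ring.
rewrite [LHS]surjective_pairing.
rewrite cosD sinD sa; move: w1 w2 dn.
move: (dot z w) (cross z w) => d k w1 w2 dn.
rewrite zE /= in w1 w2.
have r2n : r ^+ 2 != 0 by rewrite expf_neq0.
congr pair.
  by apply: (mulfI r2n); rewrite w1; field; rewrite ?rn ?cn ?dn.
by apply: (mulfI r2n); rewrite w2; field; rewrite ?rn ?cn ?dn.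
Qed.

(** Every nonzero vector makes an acute angle with one of the four axis directions. *)
Lemma is_angle_exists z : z <> (0, 0) -> exists t, is_angle z t.
Proof.
move=> z0.
have unit_angle t : is_angle (cos t, sin t) t by exists 1; rewrite ?mul1r.
suff [t] : exists t, 0 < dot (cos t, sin t) z.
  by move=> /is_angle_step/(_ (unit_angle t)) ?; eexists; eassumption.
case: z z0 => x y z0; rewrite /dot /=.
case: (ltgtP x 0) => x0.
- by exists pi; rewrite cospi sinpi mul0r addr0 mulN1r oppr_gt0.
- by exists 0; rewrite cos0 sin0 mul0r addr0 mul1r.
- case: (ltgtP y 0) => y0.
  + exists (- (pi / 2)).
    by rewrite cosN sinN cos_pihalf sin_pihalf mul0r add0r mulN1r oppr_gt0.
  + by exists (pi / 2); rewrite cos_pihalf sin_pihalf mul0r add0r mul1r.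
  + by exfalso; apply: z0; rewrite x0 y0.
Qed.
End Angle.

Section Lift.
Variable R : realType.

Lemma dot_continuous (T : topologicalType) (f g : T -> R * R) :
  continuous f -> continuous g -> continuous (fun x => dot (f x) (g x)).
Proof.
move=> cf cg x; apply: cvgD; apply: cvgM.
- exact: (continuousT_comp cf (@fst_continuous R R)).
- exact: (continuousT_comp cg (@fst_continuous R R)).
- exact: (continuousT_comp cf (@snd_continuous R R)).
- exact: (continuousT_comp cg (@snd_continuous R R)).
Qed.

Lemma cross_continuous (T : topologicalType) (f g : T -> R * R) :
  continuous f -> continuous g -> continuous (fun x => cross (f x) (g x)).
Proof.
move=> cf cg x; apply: cvgB; apply: cvgM.
- exact: (continuousT_comp cf (@fst_continuous R R)).
- exact: (continuousT_comp cg (@snd_continuous R R)).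
- exact: (continuousT_comp cf (@snd_continuous R R)).
- exact: (continuousT_comp cg (@fst_continuous R R)).
Qed.

Lemma turn_continuous (T : topologicalType) (f g : T -> R * R) x :
  continuous f -> continuous g -> 0 < dot (f x) (g x) ->
  {for x, continuous (fun x => atan (cross (f x) (g x) / dot (f x) (g x)))}.
Proof.
move=> cf cg d0.
apply: (@continuous_comp _ _ _ (fun x => cross (f x) (g x) / dot (f x) (g x))); last first.
  exact: continuous_atan.
apply: cvgM; first exact: cross_continuous.
by apply: cvgV; [rewrite gt_eqF|exact: dot_continuous].
Qed.

Lemma dot_gt0 (z : R * R) : z <> (0, 0) -> 0 < dot z z.
Proof.
case: z => x y z0; rewrite /dot /= -!expr2 lt_neqAle addr_ge0 ?sqr_ge0// andbT eq_sym.
rewrite paddr_eq0 ?sqr_ge0// !sqrf_eq0.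
by apply/negP => /andP[/eqP x0 /eqP y0]; apply: z0; rewrite x0 y0.
Qed.

Definition unit_square : set (R * R) := `[0, 1]%classic `*` `[0, 1]%classic.

(** Compactness of the square makes the radius uniform. The conclusion is the
    acuteness required by [is_angle_step]. *)
Lemma uniform_dot_gt0 (f : R * R -> R * R) :
  continuous f -> (forall x, f x <> (0, 0)) ->
  exists N : nat, forall x y, unit_square x -> ball x (N.+1%:R^-1) y ->
    0 < dot (f x) (f y).
Proof.
move=> cf f0.
have /compact_near_coveringP cK : compact unit_square.
  by apply: compact_setX; exact: segment_compact.
have /(cK nat \oo (fun N x => forall y, ball x (N.+1%:R^-1) y -> 0 < dot (f x) (f y))) :
  forall x, unit_square x -> \forall x' \near x & N \near \oo,
    forall y, ball x' (N.+1%:R^-1) y -> 0 < dot (f x') (f y).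
  move=> x _.
  have c2 : continuous (fun u : (R * R) * (R * R) => dot (f u.1) (f u.2)).
    apply: dot_continuous.
      exact: (continuousT_comp (@fst_continuous _ _) cf).
    exact: (continuousT_comp (@snd_continuous _ _) cf).
  have := c2 (x, x) [set r | 0 < r].
  case; first by apply: open_nbhs_nbhs; split; [exact: open_gt|exact: dot_gt0].
  move=> [A B] /= [].
  rewrite -!nbhs_ballE => -[e1 /= e10 A1] [e2 /= e20 B2] AB.
  pose e := Num.min e1 (e2 / 2).
  have e0 : 0 < e by rewrite lt_min e10 divr_gt0.
  exists (ball x e, [set N | N.+1%:R^-1 < e2 / 2]).
    split => /=; first exact: nbhsx_ballx.
    have h := @near_infty_natSinv_lt R (PosNum (divr_gt0 e20 (ltr0n _ 2))).
    exact: h.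
  move=> [x' N] [/= xx' Ne] y x'y.
  apply: (AB (x', y)); split => /=.
    by apply: A1; apply: le_ball xx'; rewrite ge_min lexx.
  apply: B2; rewrite (splitr e2); apply: ball_triangle.
    by apply: le_ball xx'; rewrite ge_min lexx orbT.
  by apply: le_ball x'y; exact: ltW.
by move=> [N _ /(_ N (leqnn N))] h; exists N => x y /h; exact.
Qed.

(** With M the number of steps, f(x) is reached from f(0) along the segment [0, x]
    through the points (k/M) x; the angle is the sum of the M turns, each of them
    given by [is_angle_step], hence continuous in x. No gluing of local lifts is
    needed because the square is star-shaped at the corner 0. *)
Lemma unit_square_angle (f : R * R -> R * R) :
  continuous f -> (forall x, f x <> (0, 0)) ->
  exists2 phi : R * R -> R, continuous phi &
    forall x, unit_square x -> is_angle (f x) (phi x).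
Proof.
move=> cf f0; have [N hN] := uniform_dot_gt0 cf f0.
pose M := N.+2.
pose g (k : nat) (x : R * R) : R * R :=
  (k%:R / M%:R * clamp x.1, k%:R / M%:R * clamp x.2).
have M0 : 0 < M%:R :> R by rewrite ltr0n.
have cg k : continuous (g k).
  apply: pair_continuous => x; apply: cvgM; try exact: cvg_cst.
    exact: (continuousT_comp (@fst_continuous R R) (@continuous_clamp R)).
  exact: (continuousT_comp (@snd_continuous R R) (@continuous_clamp R)).
have gs k x : (k <= M)%N -> unit_square (g k x).
  move=> kM; have k1 : 0 <= (k%:R / M%:R : R) <= 1.
    by rewrite divr_ge0//= ler_pdivrMr// mul1r ler_nat.
  case/andP: k1 => k0 k1; have [/andP[a0 a1] /andP[b0 b1]] := (clamp_itv x.1, clamp_itv x.2).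
  by split; rewrite /= in_itv/= mulr_ge0//= mulr_ile1.
have gball k x : ball (g k x) (N.+1%:R^-1) (g k.+1 x).
  have h (a : R) : 0 <= a <= 1 ->
      ball (k%:R / M%:R * a) (N.+1%:R^-1) (k.+1%:R / M%:R * a).
    move=> /andP[a0 a1]; rewrite /ball /= -mulrBl -mulrBl -natr1 opprD addrA subrr add0r.
    rewrite mulN1r mulNr normrN ger0_norm; last by rewrite mulr_ge0// invr_ge0 ltW.
    apply: (@le_lt_trans _ _ M%:R^-1); first by rewrite ler_piMr// invr_ge0 ltW.
    by rewrite ltf_pV2 ?posrE ?ltr0n// ltr_nat.
  by split; apply: h; exact: clamp_itv.
suff /(_ M (leqnn M)) [phi cphi phiE] : forall k, (k <= M)%N ->
    exists2 phi : R * R -> R, continuous phi & forall x, is_angle (f (g k x)) (phi x).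
  exists phi => // x [/= x1 x2].
  rewrite !in_itv/= in x1 x2.
  by have := phiE x; rewrite /g divff ?gt_eqF// !mul1r !clamp_id// -surjective_pairing.
elim=> [_|k IH kM].
  have [t ft] := is_angle_exists (f0 (0, 0)).
  exists (fun=> t); first by move=> x; exact: cvg_cst.
  by move=> x; rewrite /g !mul0r.
have [phi cphi phiE] := IH (ltnW kM).
have d0 x : 0 < dot (f (g k x)) (f (g k.+1 x)).
  by apply: hN; [exact/gs/ltnW|exact: gball].
have cfg j : continuous (f \o g j) by exact: continuousT_comp.
exists (fun x => phi x + atan (cross (f (g k x)) (f (g k.+1 x)) /
                               dot (f (g k x)) (f (g k.+1 x)))).
  move=> x; apply: cvgD; first exact: cphi.
  apply: (@turn_continuous _ (f \o g k) (f \o g k.+1) x (cfg _) (cfg _)); exact: d0.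
by move=> x; exact: is_angle_step.
Qed.
End Lift.

Section GlobalAngle.
Variables (R : realType) (E : topologicalType) (f : E -> R * R).
Hypotheses (cf : continuous f) (f0 : forall e, f e <> (0, 0)).

(** The pull-back to E of the universal covering of the punctured plane. *)
Definition angle_graph : set (E * R) := [set p | is_angle (f p.1) p.2].

(** A loop in E bounds a homotopy H, and the angle of f \o H lifts to the square.
    The lift is constant on the three sides that H maps to the base point e, so
    it takes the same value at both ends of the fourth one, which is the loop. *)
Lemma loop_angle e (s t : R) (c : R -> E * R) :
  simply_connected R E -> is_path angle_graph (e, s) (e, t) c -> s = t.
Proof.
move=> [_ sE] /path_clamp[]; set d := c \o clamp => cd d0 d1 dA.
have lp : is_path [set: E] e e (fst \o d).
  have -> : is_path [set: E] e e = is_path [set: E] ((fst \o d) 0) ((fst \o d) 1).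
    by rewrite /= d0 d1.
  by apply: is_pathW => //; exact: (continuousT_comp cd (@fst_continuous E R)).
have [H [cH H0 H1 Hs]] := sE _ _ lp.
pose K (u : R * R) := H (clamp u.1, clamp u.2).
have cK : continuous K.
  pose C2 (u : R * R) := (clamp u.1, clamp u.2).
  rewrite -[K]/(H \o C2); apply: continuous_within_comp cH.
    apply: pair_continuous.
      exact: (continuousT_comp (@fst_continuous R R) (@continuous_clamp R)).
    exact: (continuousT_comp (@snd_continuous R R) (@continuous_clamp R)).
  by move=> _ [u _ <-]; split; rewrite /= in_itv/= clamp_itv.
have [phi cphi phiE] : exists2 phi : R * R -> R, continuous phi &
    forall x, unit_square x -> is_angle (f (K x)) (phi x).
  by apply: unit_square_angle => [|x]; [exact: continuousT_comp cK cf|exact: f0].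
have I0 : (0 <= (0 : R) <= 1) by rewrite lexx ler01.
have I1 : (0 <= (1 : R) <= 1) by rewrite lexx ler01.
have vert (a : R) : 0 <= a <= 1 -> (forall b, 0 <= b <= 1 -> H (a, b) = H (a, 0)) ->
    phi (a, 0) = phi (a, 1).
  move=> a01 Ha; apply/eqP; rewrite -subr_eq0; apply/eqP.
  rewrite -[RHS](subrr (phi (a, 1))).
  apply: (@connected_cos_eq1 R R `[0, 1]%classic (fun b : R => phi (a, b) - phi (a, 1)) 0 1).
  - exact: segment_connected.
  - move=> b; apply: cvgB; last exact: cvg_cst.
    apply: (continuousT_comp _ cphi); apply: pair_continuous => x; first exact: cvg_cst.
    exact: cvg_id.
  - move=> b; rewrite /= in_itv/= => b01.
    apply: (@is_angle_cosB _ (f (K (a, b)))).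
      by apply: phiE; split; rewrite /= in_itv.
    have -> : K (a, b) = K (a, 1) by rewrite /K/= !clamp_id// Ha// [RHS]Ha.
    by apply: phiE; split; rewrite /= in_itv.
  - by rewrite /= in_itv.
  - by rewrite /= in_itv.
have horiz (b : R) : 0 <= b <= 1 -> (forall a, 0 <= a <= 1 -> H (a, b) = e) ->
    phi (0, b) = phi (1, b).
  move=> b01 Hb; apply/eqP; rewrite -subr_eq0; apply/eqP.
  rewrite -[RHS](subrr (phi (1, b))).
  apply: (@connected_cos_eq1 R R `[0, 1]%classic (fun a : R => phi (a, b) - phi (1, b)) 0 1).
  - exact: segment_connected.
  - move=> a; apply: cvgB; last exact: cvg_cst.
    apply: (continuousT_comp _ cphi); apply: pair_continuous => x; last exact: cvg_cst.
    exact: cvg_id.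
  - move=> a; rewrite /= in_itv/= => a01.
    apply: (@is_angle_cosB _ (f (K (a, b)))).
      by apply: phiE; split; rewrite /= in_itv.
    have -> : K (a, b) = K (1, b) by rewrite /K/= !clamp_id// Hb// Hb.
    by apply: phiE; split; rewrite /= in_itv.
  - by rewrite /= in_itv.
  - by rewrite /= in_itv.
have top : phi (0, 0) = phi (0, 1).
  rewrite horiz//; last by move=> a /Hs[].
  rewrite [RHS]horiz//; last by move=> a /Hs[].
  by apply: vert => // b b01; rewrite H1// H1.
have : phi (0, 0) - (snd \o d) 0 = phi (0, 1) - (snd \o d) 1.
  apply: (@connected_cos_eq1 R R `[0, 1]%classic (fun b : R => phi (0, b) - (snd \o d) b) 0 1).
  - exact: segment_connected.
  - move=> b; apply: cvgB; last exact: (continuousT_comp cd (@snd_continuous E R)).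
    apply: (continuousT_comp _ cphi); apply: pair_continuous => x; first exact: cvg_cst.
    exact: cvg_id.
  - move=> b; rewrite /= in_itv/= => b01.
    apply: (@is_angle_cosB _ (f (K (0, b)))).
      by apply: phiE; split; rewrite /= in_itv.
    by rewrite /K/= !clamp_id// H0//; exact: dA.
  - by rewrite /= in_itv.
  - by rewrite /= in_itv.
by rewrite /= d0 d1 top => /addrI/oppr_inj.
Qed.

(** The angle of f e is the one reached by following it from e0 along any path to
    e, and [loop_angle] makes it independent of the path. *)
Lemma global_angle : simply_connected R E -> locally_path_connected R E ->
  exists2 theta : E -> R, continuous theta & forall e, is_angle (f e) (theta e).
Proof.
move=> sE lE; have [[e0 _]|E0] := pselect ([set: E] !=set0); last first.
  by exists (fun=> 0) => e; exfalso; apply: E0; exists e.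
have [t0 ft0] := is_angle_exists (@f0 e0).
pose G e t := exists c : R -> E * R, is_path angle_graph (e0, t0) (e, t) c.
(* two paths of the graph to the fiber of e make up, one reversed, a path
   whose projection is a loop *)
have Gfun e s t : G e s -> G e t -> s = t.
  move=> [c /path_rev[c' hc']] [d hd].
  have [c'' hc''] := path_cat hc' hd; exact: loop_angle hc''.
have Gtot e : exists t, G e t.
  have [c /path_clamp[]] := sE.1 e0 e I I.
  set d := c \o clamp => cd d0 d1 _.
  have [phi cphi phiE] : exists2 phi : R * R -> R, continuous phi &
      forall x, unit_square x -> is_angle (f (d x.1)) (phi x).
    apply: (@unit_square_angle _ (f \o d \o fst)) => [|x]; last exact: f0.
    by apply: (continuousT_comp _ (continuousT_comp cd cf)); exact: fst_continuous.
  have I0 : (0 <= (0 : R) <= 1) by rewrite lexx ler01.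
  have p0 : is_angle (f e0) (phi (0, 0)).
    by rewrite -d0; apply: (phiE (0, 0)); split; rewrite /= in_itv.
  (* the lift starts at some angle of f e0, to be shifted to t0 *)
  exists (phi (1, 0) + (t0 - phi (0, 0))).
  pose p (t : R) := (d t, phi (t, 0) + (t0 - phi (0, 0))).
  exists p.
  have -> : (e, phi (1, 0) + (t0 - phi (0, 0))) = p 1 by rewrite /p d1.
  have -> : (e0, t0) = p 0 by rewrite /p d0; congr pair; ring.
  apply: is_pathW.
    apply: pair_continuous => // t; apply: cvgD; last exact: cvg_cst.
    apply: (continuousT_comp _ cphi); apply: pair_continuous => x; last exact: cvg_cst.
    exact: cvg_id.
  move=> t t01.
  have [r r0 rE] : is_angle (f (d t)) (phi (t, 0)).
    by apply: (phiE (t, 0)); split; rewrite /= in_itv.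
  have c1 := is_angle_cosB ft0 p0.
  have s0 : sin (t0 - phi (0, 0)) = 0 by apply: cos1sin0; rewrite c1 normr1.
  by exists r => //; rewrite /p/= rE cosD [sin (phi _ + _)]sinD c1 s0 !mulr0 !mulr1 subr0 addr0.
have [theta thetaG] := choice Gtot.
have thetaA e : is_angle (f e) (theta e).
  have [c [_ _ c1 cA]] := thetaG e.
  by have := cA 1; rewrite /angle_graph/= c1/=; apply; rewrite lexx ler01.
exists theta => // e.
pose turn e' := atan (cross (f e) (f e') / dot (f e) (f e')).
have turnC e' : 0 < dot (f e) (f e') -> {for e', continuous turn}.
  move=> d0; apply: (@turn_continuous _ _ (fun=> f e) f) => //.
  by move=> x; exact: cvg_cst.
have dc : continuous (fun e' => dot (f e) (f e')).
  by apply: dot_continuous => // x; exact: cvg_cst.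
have oD : open [set e' | 0 < dot (f e) (f e')].
  exact: ((continuousP _).1 dc [set r | 0 < r] (@open_gt R 0)).
have De : 0 < dot (f e) (f e) by exact: dot_gt0.
have [V [oV Ve VD pV]] := lE e _ (open_nbhs_nbhs (conj oD De)).
(* prolong a path to e inside V, where the turn from f e stays acute *)
have tV e' : V e' -> theta e' = theta e + turn e'.
  move=> Ve'; apply: (Gfun e') => //.
  have [c hc] := thetaG e.
  have [g /path_clamp[]] := pV _ _ Ve Ve'; set h := g \o clamp => ch h0 h1 hV.
  pose p (t : R) := (h t, theta e + turn (h t)).
  suff hp : is_path angle_graph (e, theta e) (e', theta e + turn e') p.
    exact: path_cat hc hp.
  have turne : turn e = 0.
    by rewrite /turn (_ : cross _ _ = 0) ?mul0r ?atan0// /cross mulrC subrr.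
  have -> : (e, theta e) = p 0 by rewrite /p h0 turne addr0.
  have -> : (e', theta e + turn e') = p 1 by rewrite /p h1.
  apply: is_pathW.
    apply: pair_continuous => // t; apply: cvgD; first exact: cvg_cst.
    by apply: continuous_comp; [exact: ch|apply: turnC; exact: (VD _ (hV t))].
  by move=> t _; apply: is_angle_step => //; exact: (VD _ (hV t)).
have nV : \forall e' \near e, theta e + turn e' = theta e'.
  by apply: filterS (open_nbhs_nbhs (conj oV Ve)) => e' /tV.
have lim : (theta e + turn e') @[e' --> e] --> theta e + turn e.
  by apply: cvgD; [exact: cvg_cst|exact: turnC].
rewrite /continuous_at tV//; apply: cvg_trans lim.
exact: near_eq_cvg.
Qed.
End GlobalAngle.

(** * Countability *)

(** A set is countable when its elements are told apart by labels taken from a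
    countable set; the labels need not be chosen. *)
Lemma countable_correspondence (T U : Type) (A : set T) (C : set U) (r : U -> T -> Prop) :
  countable A -> (forall c, C c -> exists2 a, A a & r c a) ->
  (forall c c' a, C c -> C c' -> r c a -> r c' a -> c = c') -> countable C.
Proof.
move=> cA tot inj.
have [[c0 C0]|/set0P/negP] := pselect (C !=set0); last first.
  by rewrite negbK => /eqP ->; exact: countable0.
have /choice[h hP] a : exists c, (exists2 c, C c & r c a) -> C c /\ r c a.
  have [[c Cc rc]|] := pselect (exists2 c, C c & r c a); last by exists c0.
  by exists c.
apply: (sub_countable _ cA); apply: card_le_trans (card_image_le h A).
apply: subset_card_le => c Cc; have [a Aa rca] := tot c Cc.
have [Ch rh] : C (h a) /\ r (h a) a by apply: hP; exists c.
by exists a => //; exact: inj rh rca.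
Qed.


Lemma countable_infinite_card (T : Type) (A : set T) (h : nat -> T) :
  countable A -> (forall k, A (h k)) -> injective h -> (A #= [set: nat])%card.
Proof.
move=> cA Ah ih; rewrite card_eq_le; apply/andP; split => //.
apply: (@card_le_trans _ _ _ (h @` setT)).
  by have := inj_card_eq (in2W ih : {in [set: nat] &, injective h}); rewrite card_eq_le => /andP[].
by apply: subset_card_le => _ [k _ <-].
Qed.

(** * Coverings *)

Section Covering.
Variables (E B : topologicalType) (q : E -> B).
Hypothesis covq : is_covering q.

(** Over an evenly covered open set, the section of q through e composed with g
    has a connected graph D. *)
Lemma covering_lift_near (R : realType) (g : R -> B) (t : R) : continuous g ->
  exists J : set R, [/\ open J, J t &
    forall s e, J s -> q e = g s -> exists D : set (R * E),
      [/\ connected D, D `<=` [set p | q p.2 = g p.1], D (s, e) &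
          forall s', J s' -> exists e', D (s', e')]].
Proof.
move=> cg; have [_ _ /(_ (g t))[U [oU Ugt [F [tF FU hF]]]]] := covq.
have /nbhs_ballP[r /= r0 rU] : nbhs t (g @^-1` U).
  by apply: cg; exact: open_nbhs_nbhs.
have cJ : connected (ball t r : set R).
  by apply/connected_intervalP; rewrite ball_itv; exact: interval_is_interval.
exists (ball t r); split; [exact: ball_open|exact: ballxx|].
move=> s e Js qe.
have [V FV Ve] : (\bigcup_(V in F) V) e by rewrite FU /= qe; exact: rU.
have [oV iV VU opV] := hF V FV.
have /choice[l lP] s' : exists e', ball t r s' -> V e' /\ q e' = g s'.
  have [/rU|] := pselect (ball t r s'); last by exists e.
  by rewrite /= -VU => -[e' Ve' qe']; exists e'.
have cl : {within ball t r, continuous l}.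
  apply/subspace_continuousP => x Jx W /=.
  rewrite nbhsE => -[W' [oW' W'lx] W'W].
  have [Vlx qlx] := lP x Jx.
  have /open_nbhs_nbhs : open_nbhs (g x) (q @` (W' `&` V)).
    split; first by apply: opV; [exact: openI|exact: subIsetr].
    by exists (l x).
  move=> /cg; rewrite nbhs_simpl /= => h.
  rewrite /within /=; near_simpl; apply: filterS h => y [w [W'w Vw] qw] Jy.
  have [Vly qly] := lP y Jy.
  suff ly : l y = w by rewrite /from_subspace ly; exact: W'W.
  by apply: iV; rewrite ?inE// qly qw.
exists ((fun x => (x, l x)) @` (ball t r)); split.
- apply: connected_continuous_connected => //.
  exact: (@pair_continuous (subspace (ball t r)) R E incl_subspace l
    (@incl_subspace_continuous _ _) cl).
- by move=> _ [x Jx <-] /=; have [] := lP x Jx.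
- have [Vls qls] := lP s Js; exists s => //; congr pair.
  by apply: iV; rewrite ?inE// qls qe.
- by move=> s' Js'; exists (l s'); exists s'.
Qed.

(** Path lifting stated with connected sets: D is a connected part of the pull-back
    of q along g that reaches above t. The set of the t that are reached is open
    and closed by [covering_lift_near]; no continuous lift has to be assembled. *)
Lemma covering_lift (R : realType) (g : R -> B) (t0 : R) (e0 : E) :
  continuous g -> q e0 = g t0 ->
  forall t, exists D : set (R * E),
    [/\ connected D, D `<=` [set p | q p.2 = g p.1], D (t0, e0) &
        exists e, D (t, e)].
Proof.
move=> cg q0.
pose Z := [set t | exists D : set (R * E),
    [/\ connected D, D `<=` [set p | q p.2 = g p.1], D (t0, e0) &
        exists e, D (t, e)]].
suff ZT : Z = setT by move=> t; have : Z t by rewrite ZT.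
have step J : (forall s e, J s -> q e = g s -> exists D : set (R * E),
      [/\ connected D, D `<=` [set p | q p.2 = g p.1], D (s, e) &
          forall s', J s' -> exists e', D (s', e')]) ->
    forall s s', J s -> J s' -> Z s -> Z s'.
  move=> hJ s s' Js Js' [D [cD Dq D0 [e De]]].
  have [D' [cD' D'q D'e D's']] := hJ s e Js (Dq _ De).
  exists (D `|` D'); split.
  - by apply: connectedU => //; exists (s, e).
  - by rewrite subUset.
  - by left.
  - by have [e' D'e'] := D's' s' Js'; exists e'; right.
apply: (@connectedR R).
- exists t0; exists [set (t0, e0)]; split => //; first exact: connected1.
    by move=> _ ->.
  by exists e0.
- exists Z; last by rewrite setTI.
  rewrite openE => t Zt; have [J [oJ Jt hJ]] := covering_lift_near t cg.
  by apply: filterS (open_nbhs_nbhs (conj oJ Jt)) => s Js; exact: step hJ t s Jt Js Zt.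
- exists Z; last by rewrite setTI.
  rewrite -[Z]setCK; apply: open_closedC.
  rewrite openE => t Zt; have [J [oJ Jt hJ]] := covering_lift_near t cg.
  apply: filterS (open_nbhs_nbhs (conj oJ Jt)) => s Js Zs.
  by apply: Zt; exact: step hJ s t Js Jt Zs.
Qed.

(** Poincare-Volterra. Over each set U of a countable basis that is small enough,
    fix the family F U of the sheets of a larger evenly covered set. A sheet meets
    only countably many others, as the trace on it of a sheet of F U is determined
    by U and by any nonempty basic set in its image. The sheets joined to a given
    one by a finite chain are thus countably many; their union is open and closed,
    hence everything, and each of them meets countably many elements of C, for
    the same reason. *)
Lemma covering_countable_open_family (C : set (set E)) :
  connected [set: E] -> @second_countable B ->
  (forall V, C V -> open V /\ V !=set0) -> trivIset C id -> countable C.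
Proof.
move=> cE [b cb [bo bB]] Co tC.
have [_ _ covB] := covq.
have basic (x : B) (W : set B) : open W -> W x -> exists2 U, b U & U x /\ U `<=` W.
  move=> oW Wx; have [U [bU Ux] UW] := bB x W (open_nbhs_nbhs (conj oW Wx)).
  by exists U.
pose sheets (F : set (set E)) := trivIset F id /\
  forall V, F V -> [/\ open V, set_inj V q &
     forall W, open W -> W `<=` V -> open (q @` W)].
have /choice[F hF] (U : set B) : exists F : set (set E), sheets F /\
    ((exists P, [/\ U `<=` P, open P & evenly_covered q P]) ->
      q @^-1` U `<=` \bigcup_(V in F) V).
  have [[P [UO oO [F [tF FP Fh]]]]|no] :=
      pselect (exists P, [/\ U `<=` P, open P & evenly_covered q P]).
    exists F; split; last by move=> _ e /UO; rewrite FP.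
    by split=> // V /Fh[].
  by exists set0; split=> //; split=> // V.
have Fcov e : exists U V, [/\ b U, F U V & V e].
  have [P [oO Oe eO]] := covB (q e).
  have [U bU [Ue UO]] := basic _ _ oO Oe.
  have [V FV Ve] : (\bigcup_(V in F U) V) e by apply: (hF U).2 => //; exists P.
  by exists U, V.
(* sheets meeting a sheet of W *)
pose next (W : set (set E)) := [set V' | exists U, b U /\ F U V' /\
   exists2 V, W V & V `&` V' !=set0].
pose good (W : set (set E)) := forall V, W V -> open V /\
  set_inj V q /\ forall W, open W -> W `<=` V -> open (q @` W).
have trace V : open V -> set_inj V q ->
    (forall W, open W -> W `<=` V -> open (q @` W)) ->
    forall V', open V' -> V `&` V' !=set0 ->
    exists2 U, b U & U !=set0 /\ U `<=` q @` (V `&` V').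
  move=> oV iV opV V' oV' [e [Ve V'e]].
  have oVV : open (q @` (V `&` V')) by apply: opV; [exact: openI|exact: subIsetl].
  have [|U bU [Ue UV]] := basic (q e) _ oVV; first by exists e.
  by exists U => //; split => //; exists (q e).
(* sheets, or elements of C, with the same label meet each other *)
have trace_inj V : set_inj V q -> forall V1 V2 (U : set B), U !=set0 ->
    U `<=` q @` (V `&` V1) -> U `<=` q @` (V `&` V2) -> V1 `&` V2 !=set0.
  move=> iV V1 V2 U [x Ux] /(_ x Ux)[e1 [Ve1 V1e1] q1] /(_ x Ux)[e2 [Ve2 V2e2] q2].
  have e12 : e1 = e2 by apply: iV; rewrite ?inE// q1 q2.
  by exists e1; split=> //; rewrite e12.
have next_good W : good W -> good (next W).
  by move=> gW V [U [_ [FV _]]]; have [] := (hF U).1.2 V FV.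
have next_countable W : good W -> countable W -> countable (next W).
  move=> gW cW.
  apply: (@countable_correspondence _ _ (W `*` (b `*` b)) _
    (fun V' a => [/\ W a.1, F a.2.1 V', a.2.2 !=set0 & a.2.2 `<=` q @` (a.1 `&` V')])).
  - by apply: countableX => //; exact: countableX.
  - move=> V' [U [bU [FV' [V WV VV']]]]; have [oV [iV opV]] := gW V WV.
    have [oV' _ _] := (hF U).1.2 V' FV'.
    have [U' bU' [U'0 U'V]] := trace V oV iV opV V' oV' VV'.
    by exists (V, (U, U')).
  - move=> V1 V2 [V [U U']] /= _ _ [WV F1 U0 U1] [_ F2 _ U2].
    apply: (hF U).1.1 => //; apply: trace_inj U1 U2 => //.
    by have [_ []] := gW V WV.
have [[e0 _]|E0] := pselect ([set: E] !=set0); last first.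
  suff -> : C = set0 by exact: countable0.
  by rewrite -subset0 => V /Co[_ [e _]]; apply: E0; exists e.
have [U0 [V0 [bU0 FV0 V0e0]]] := Fcov e0.
pose W n := iter n next [set V0].
have gW n : good (W n).
  elim: n => [|n IH]; last exact: next_good.
  by move=> _ ->; have [] := (hF U0).1.2 V0 FV0.
have cW n : countable (W n).
  by elim: n => [|n IH]; [exact: countable1|exact: next_countable].
pose WW := \bigcup_n W n.
have cWW : countable WW by exact: bigcup_countable.
pose Om := \bigcup_(V in WW) V.
have OmT : Om = setT.
  apply: cE.
  - by exists e0, V0 => //; exists 0%N.
  - exists Om; last by rewrite setTI.
    by apply: bigcup_open => V [n _ /gW[]].
  - exists Om; last by rewrite setTI.
    rewrite -[Om]setCK; apply: open_closedC.
    rewrite openE => e Ome; have [U [V [bU FV Ve]]] := Fcov e.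
    have [oV _ _] := (hF U).1.2 V FV.
    apply: filterS (open_nbhs_nbhs (conj oV Ve)) => e' Ve' [V' [n _ WV'] V'e'].
    apply: Ome; exists V => //; exists n.+1 => //; exists U; split=> //; split=> //.
    by exists V' => //; exists e'.
apply: (@countable_correspondence _ _ (WW `*` b) _
    (fun V a => [/\ WW a.1, a.2 !=set0 & a.2 `<=` q @` (a.1 `&` V)])).
- exact: countableX.
- move=> V CV; have [oV [e Ve]] := Co V CV.
  have [V' WV' V'e] : Om e by rewrite OmT.
  have [n _ /gW[oV' [iV' opV']]] := WV'.
  have [|U' bU' [U'0 U'V]] := trace V' oV' iV' opV' V oV; first by exists e.
  by exists (V', U').
- move=> V1 V2 [V U'] /= C1 C2 [[n _ /gW[_ [iV _]]] U0' U1] [_ _ U2].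
  by apply: tC => //; exact: trace_inj U0' U1 U2.
Qed.
End Covering.

(** * Squares in the plane and the harmonic points *)

Section Plane.
Variable R : realType.
Implicit Types z w : R * R.

Lemma plane_second_countable : @second_countable (R * R)%type.
Proof.
pose b (i : rat * rat * nat) : set (R * R) := ball (ratr i.1.1 : R, ratr i.1.2 : R) (i.2.+1%:R^-1).
exists (range b).
  by apply: (sub_countable (card_image_le b setT)); exact: countableP.
split; first by move=> _ [i _ <-]; exact: ball_open.
move=> z W /nbhs_ballP[r /= r0 rW].
have [k _ /(_ k (leqnn k)) /= kr] :=
  @near_infty_natSinv_lt R (PosNum (divr_gt0 r0 (ltr0n R 2))).
have k0 : 0 < k.+1%:R^-1 :> R by rewrite invr_gt0.
have rat_near (x : R) : exists a : rat, ball x (k.+1%:R^-1) (ratr a).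
  have [|y [xy [a _ ay]]] := @dense_rat R (ball x (k.+1%:R^-1)) _ (ball_open _ _).
    by exists x; exact: ballxx.
  by exists a; rewrite ay.
have [[a1 h1] [a2 h2]] := (rat_near z.1, rat_near z.2).
have zb : ball (ratr a1 : R, ratr a2 : R) (k.+1%:R^-1) z by split; exact/ball_sym.
exists (b (a1, a2, k)); first by split => //; exists (a1, a2, k).
move=> w /= bw; apply: rW; rewrite (splitr r).
apply: (@ball_triangle _ _ (ratr a1 : R, ratr a2 : R)).
  by apply/ball_sym; apply: le_ball zb; exact: ltW.
by apply: le_ball bw; exact: ltW.
Qed.

Lemma second_countable_subtype (T : topologicalType) (A : set T) :
  @second_countable T -> @second_countable A.
Proof.
move=> [b cb [bo bB]]; exists ((fun U => set_val @^-1` U) @` b : set (set A)).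
  exact: (sub_countable (card_image_le _ b)).
split; first by move=> _ [U bU <-]; exists U => //; exact: bo.
move=> x W [W' [[V oV <-] Vx] VW].
have [U [bU Ux] UV] := bB (set_val x) V (open_nbhs_nbhs (conj oV Vx)).
exists (set_val @^-1` U); first by split => //; exists U.
by move=> y /= Uy; apply: VW; exact: UV.
Qed.

Definition convex_plane (A : set (R * R)) := forall z w t, A z -> A w -> 0 <= t <= 1 ->
  A ((1 - t) * z.1 + t * w.1, (1 - t) * z.2 + t * w.2).

Lemma convex_connected (A : set (R * R)) : convex_plane A -> connected A.
Proof.
move=> cA; apply: star_connected => z w Az Aw.
pose c (t : R) := ((1 - t) * z.1 + t * w.1, (1 - t) * z.2 + t * w.2).
exists (c @` `[0, 1]%classic); split.
- exists 0; first by rewrite /= in_itv/= lexx ler01.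
  by rewrite /c subr0 !mul1r !mul0r !addr0 -surjective_pairing.
- exists 1; first by rewrite /= in_itv/= lexx ler01.
  by rewrite /c subrr !mul1r !mul0r !add0r -surjective_pairing.
- by move=> _ [t /= t01 <-]; apply: cA => //; rewrite in_itv in t01.
- apply: connected_image; last exact: segment_connected.
  have lin (a b : R) : continuous (fun t : R => (1 - t) * a + t * b).
    move=> t; apply: cvgD; apply: cvgM; try exact: cvg_cst; last exact: cvg_id.
    by apply: cvgB; [exact: cvg_cst|exact: cvg_id].
  by apply: pair_continuous; exact: lin.
Qed.

(** The whole plane for n = 0, the square of half-side 1/n otherwise. The point
    (1/(n+1), 0) is on the boundary of the square of index n+1. *)
Definition open_square (n : nat) : set (R * R) :=
  [set z | n%:R * `|z.1| < 1 /\ n%:R * `|z.2| < 1].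

Lemma open_square0 : open_square 0 = setT.
Proof. by rewrite eqEsubset; split=> // z _; rewrite /open_square /= !mul0r ltr01. Qed.

Lemma open_square_subset n : open_square n.+1 `<=` open_square n.
Proof.
move=> z [z1 z2]; split; [apply: le_lt_trans z1|apply: le_lt_trans z2].
  by rewrite ler_wpM2r// ler_nat.
by rewrite ler_wpM2r// ler_nat.
Qed.

Lemma open_square_center n : open_square n (0, 0).
Proof. by rewrite /open_square/= normr0 mulr0 ltr01. Qed.

Lemma open_square_convex n : convex_plane (open_square n).
Proof.
have conv (x y t : R) : n%:R * `|x| < 1 -> n%:R * `|y| < 1 -> 0 <= t <= 1 ->
    n%:R * `|(1 - t) * x + t * y| < 1.
  move=> x1 y1 /andP[t0 t1].
  apply: (@le_lt_trans _ _ ((1 - t) * (n%:R * `|x|) + t * (n%:R * `|y|))).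
    have -> : (1 - t) * (n%:R * `|x|) + t * (n%:R * `|y|) =
      n%:R * ((1 - t) * `|x| + t * `|y|) by ring.
    rewrite ler_wpM2l//.
    rewrite (le_trans (ler_normD _ _))// !normrM (ger0_norm t0) ger0_norm//.
    by rewrite subr_ge0.
  have [->|tn0] := eqVneq t 0; first by rewrite subr0 mul1r mul0r addr0.
  have tp : 0 < t by rewrite lt_neqAle eq_sym tn0.
  have : t * (n%:R * `|y|) < t * 1 by rewrite ltr_pM2l.
  have : (1 - t) * (n%:R * `|x|) <= (1 - t) * 1 by rewrite ler_wpM2l ?subr_ge0// ltW.
  lra.
by move=> z w t [z1 z2] [w1 w2] t01; split; exact: conv.
Qed.

Lemma open_square_open n : open (open_square n).
Proof.
have op (g : R * R -> R) : continuous g -> open [set z | n%:R * `|g z| < 1].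
  move=> cg; have c : continuous (fun z => n%:R * `|g z|).
    move=> z; apply: cvgM; first exact: cvg_cst.
    exact: (cvg_norm (cg z)).
  exact: ((continuousP _).1 c [set r | r < 1] (@open_lt R 1)).
apply: openI; apply: op; [exact: fst_continuous|exact: snd_continuous].
Qed.

Lemma open_square_nbhs (W : set (R * R)) : nbhs (0, 0) W -> exists n, open_square n `<=` W.
Proof.
move=> /nbhs_ballP[r /= r0 rW].
have [k _ /(_ k (leqnn k)) /= kr] := @near_infty_natSinv_lt R (PosNum r0).
exists k.+1 => z [z1 z2]; apply: rW.
have small (x : R) : k.+1%:R * `|x| < 1 -> ball 0 r x.
  move=> kx; rewrite /ball/= sub0r normrN; apply: lt_trans kr.
  by rewrite -[X in _ < X]mul1r ltr_pdivlMr// mulrC.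
by split; exact: small.
Qed.

Lemma open_square_connected_nbhs n : open_connected_nbhs (0, 0) (open_square n).
Proof.
split; [exact: open_square_open|exact/convex_connected/open_square_convex|].
exact: open_square_center.
Qed.

Lemma harmonic_axis z : harmonic_points R z -> z.2 = 0.
Proof. by case=> [[n _ <-]|->]. Qed.

(** The distance from (1/(n+1), 0) to the nearest other harmonic point. *)
Definition harmonic_gap (n : nat) : R := n.+1%:R^-1 - n.+2%:R^-1.

Lemma harmonic_gapE n : harmonic_gap n = (n.+1%:R * n.+2%:R)^-1.
Proof.
have a0 : n.+1%:R != 0 :> R by rewrite pnatr_eq0.
have b0 : n.+2%:R != 0 :> R by rewrite pnatr_eq0.
have ba : n.+2%:R = n.+1%:R + 1 :> R by rewrite natr1.
rewrite /harmonic_gap; move: a0 b0; rewrite {}ba; move: (n.+1%:R : R) => a a0 b0.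
by field; rewrite a0 b0.
Qed.

Lemma harmonic_gap_gt0 n : 0 < harmonic_gap n.
Proof. by rewrite harmonic_gapE invr_gt0 mulr_gt0. Qed.

Lemma harmonic_gap_lt n : harmonic_gap n < n.+1%:R^-1.
Proof. by rewrite /harmonic_gap gtrBl invr_gt0. Qed.

Lemma open_square_disk n (x y r : R) : 0 < r < harmonic_gap n ->
  `|x - n.+1%:R^-1| <= r -> `|y| <= r ->
  open_square n (x, y).
Proof.
move=> /andP[r0 rn] xr yr.
have nr : n%:R * r < n.+1%:R^-1.
  apply: (@le_lt_trans _ _ (n%:R * harmonic_gap n)); first by rewrite ler_wpM2l// ltW.
  rewrite harmonic_gapE invfM mulrCA -[X in _ < X]mulr1 ltr_pM2l ?invr_gt0//.
  by rewrite ltr_pdivrMr// mul1r ltr_nat leqnSn.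
have n1 : n%:R * n.+1%:R^-1 = 1 - n.+1%:R^-1 :> R.
  have a0 : n.+1%:R != 0 :> R by rewrite pnatr_eq0.
  have na : n%:R = n.+1%:R - 1 :> R by rewrite -natr1 addrK.
  rewrite na; move: (n.+1%:R : R) a0 => a a0.
  by field.
have s1 : n.+1%:R^-1 <= 1 :> R by rewrite invf_le1// ler1n.
move: nr n1 s1 xr; rewrite /= => nr n1 s1 xr.
have s0 : 0 <= n.+1%:R^-1 :> R by rewrite invr_ge0.
move: (n.+1%:R^-1 : R) nr n1 s1 xr s0 => s nr n1 s1 xr s0.
split => /=.
  have xs : `|x| <= s + r.
    rewrite -[x](subrK s) (le_trans (ler_normD _ _))// (ger0_norm s0) addrC.
    by rewrite lerD2l.
  have : n%:R * `|x| <= n%:R * (s + r) by rewrite ler_wpM2l.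
  by rewrite mulrDr n1; lra.
have : n%:R * `|y| <= n%:R * r by rewrite ler_wpM2l.
by lra.
Qed.

Lemma harmonic_isolated n (x y r : R) : 0 < r < harmonic_gap n ->
  (x - n.+1%:R^-1) ^+ 2 + y ^+ 2 = r ^+ 2 -> ~ harmonic_points R (x, y).
Proof.
move=> /andP[r0 rn] E H; have /= y0 := harmonic_axis H.
move: E; rewrite y0 expr0n addr0 => /eqP; rewrite eqf_sqr => E.
have xr : `|x - n.+1%:R^-1| = r.
  by case/orP: E => /eqP ->; rewrite ?normrN gtr0_norm.
have rl := harmonic_gap_lt n.
case: H => [[m /= m0 [xm _]]|[x0 _]]; last first.
  move: xr; rewrite x0 sub0r normrN gtr0_norm ?invr_gt0// => sr.
  by move: rl; rewrite sr ltNge (ltW rn).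
rewrite -xm in xr.
have [mn|nm|mn] := ltngtP m n.+1.
- have n0 : (0 < n)%N by rewrite (leq_trans m0).
  have h1 : n%:R^-1 <= m%:R^-1 :> R by rewrite lef_pV2 ?posrE ?ltr0n// ler_nat.
  have h2 : harmonic_gap n <= harmonic_gap n.-1.
    rewrite !harmonic_gapE prednK// lef_pV2 ?posrE ?mulr_gt0 ?ltr0n// -!natrM ler_nat.
    by rewrite mulnC leq_mul2l/= leqW// leqnSn.
  move: xr rn h1 h2; rewrite [harmonic_gap n.-1]/harmonic_gap prednK// ger0_norm; last first.
    by rewrite subr_ge0 lef_pV2 ?posrE ?ltr0n// ltW// ltr_nat.
  move: (n.+1%:R^-1 : R) (m%:R^-1 : R) (n%:R^-1 : R) (harmonic_gap n) => s m' n' d.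
  by lra.
- have h1 : m%:R^-1 <= n.+2%:R^-1 :> R by rewrite lef_pV2 ?posrE ?ltr0n// ler_nat.
  move: xr rn h1; rewrite /harmonic_gap distrC ger0_norm; last first.
    by rewrite subr_ge0 lef_pV2 ?posrE ?ltr0n// ltW// ltr_nat.
  move: (n.+1%:R^-1 : R) (m%:R^-1 : R) (n.+2%:R^-1 : R) => s m' s'.
  by lra.
- by move: xr; rewrite mn subrr normr0 => r00; rewrite r00 ltxx in r0.
Qed.

End Plane.

(** * Components of preimages of the squares *)

Lemma covering_open (E B : topologicalType) (q : E -> B) (W : set E) :
  is_covering q -> open W -> open (q @` W).
Proof.
move=> [_ _ covB] oW; rewrite openE => _ [e We <-].
have [U [oU Uqe [F [tF FU hF]]]] := covB (q e).
have [V FV Ve] : (\bigcup_(V in F) V) e by rewrite FU.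
have [oV _ _ opV] := hF V FV.
have oqV : open (q @` (W `&` V)) by apply: opV; [exact: openI|exact: subIsetr].
have qe : (q @` (W `&` V)) (q e) by exists e.
rewrite /interior; apply: filterS (open_nbhs_nbhs (conj oqV qe)).
by move=> _ [e' [We' _] <-]; exists e'.
Qed.

(** Relatively open and closed subsets are transported by the embedding. *)
Lemma embedding_connected (X Y : topologicalType) (i : X -> Y) (A : set X) :
  embedding i -> connected (i @` A) -> connected A.
Proof.
move=> [inji topi] cA B B0 [C oC BC] [D cD BD].
have [C' oC' CC'] := (topi C).1 oC.
have [D' oD' DD'] := (topi (~` D)).1 (closed_openC cD).
have DE : D = i @^-1` (~` D') by rewrite -[D]setCK DD'.
have iB : i @` B = i @` A.
  apply: cA.
  - by case: B0 => b Bb; exists (i b); exists b.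
  - exists C' => //; rewrite BC CC'; apply/seteqP; split.
      by move=> _ [x [Ax Cx] <-]; split=> //; exists x.
    by move=> _ [[x Ax <-] Cx]; exists x.
  - exists (~` D'); first exact: open_closedC.
    rewrite BD DE; apply/seteqP; split.
      by move=> _ [x [Ax Cx] <-]; split=> //; exists x.
    by move=> _ [[x Ax <-] Cx]; exists x.
apply/seteqP; split=> x xin; have := imageP i xin.
  by rewrite iB => -[y Ay /inji <-].
by rewrite -iB => -[y Ay /inji <-].
Qed.

Lemma set_val_inj (T : Type) (A : set T) : injective (@set_val T A).
Proof. by rewrite set_valE; exact: val_inj. Qed.

Lemma corestrict_continuous (T U : topologicalType) (A : set U) (g : T -> U) :
  continuous g -> (forall t, A (g t)) ->
  exists2 g' : T -> A, continuous g' & forall t, set_val (g' t) = g t.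
Proof.
move=> cg gA; exists (fun t => SigSub (mem_set (gA t))); last by move=> t; rewrite set_valE.
apply/continuousP => _ [V oV <-].
exact: ((continuousP _).1 cg V oV).
Qed.

Section Branched.
Variables (R : realType) (X : topologicalType) (p : X -> R * R).
Variables (E : topologicalType) (q : E -> ~` (harmonic_points R)) (i : E -> X).
Hypotheses (covq : is_covering q) (sE : simply_connected R E).
Hypothesis compl : is_completion R (set_val \o q) p i.

Let lX : locally_path_connected R X.
Proof. by have [_ [[_ [? _] _ _ _] _] _ _] := compl. Qed.

Let lE : locally_path_connected R E.
Proof. by have [[_ [? _] _ _ _] _ _ _] := compl. Qed.

Let cp : continuous p.
Proof. by have [_ [[_ _ _ ? _] _] _ _] := compl. Qed.

Let ci : continuous i.
Proof.
have [_ _ [[_ topi] _] _] := compl.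
by apply/continuousP => A oA; apply/topi; exists A.
Qed.

Let pi_q e : p (i e) = set_val (q e).
Proof. by have [_ _ [_ /(congr1 (@^~ e))]] := compl. Qed.

Definition level_comp (n : nat) (x : X) : set X := connected_component (p @^-1` open_square n) x.

Lemma level_comp_open n x : open (level_comp n x).
Proof.
by apply: (open_component _ lX); exact: ((continuousP _).1 cp _ (@open_square_open R n)). Qed.

Lemma level_comp_refl n x : open_square n (p x) -> level_comp n x x.
Proof. by move=> px; apply: connected_component_refl. Qed.

Lemma level_comp_sub n x y : level_comp n x y -> open_square n (p y).
Proof. by move=> /connected_component_sub. Qed.

(** This is what the local connectedness of E in X is for: components computed in
    X do not merge several components of E. *)
Lemma level_comp_preimage_connected n x : connected (i @^-1` level_comp n x).
Proof.
have [_ _ [emb _] [_ _ lc]] := compl.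
apply: (embedding_connected emb).
have -> : i @` (i @^-1` level_comp n x) = level_comp n x `&` range i.
  apply/seteqP; split=> [_ [e ie <-]|y [cy [e _ ey]]]; first by split=> //; exists e.
  by exists e => //=; rewrite ey.
by apply: lc; [exact: level_comp_open|exact: component_connected].
Qed.

Lemma level_comp_meets n x : open_square n (p x) -> exists e, level_comp n x (i e).
Proof.
move=> px; have [_ _ _ [_ dn _]] := compl.
have [|y [xy [e _ ey]]] := dn (level_comp n x) _ (level_comp_open n x);
  last by exists e; rewrite ey.
by exists x; exact: connected_component_refl.
Qed.

(** A lift of a path of U_n minus the harmonic points stays in the component
    where it starts. *)
Lemma level_comp_lift n x (g : R -> R * R) t0 e0 : continuous g ->
  (forall t, open_square n (g t)) -> (forall t, ~ harmonic_points R (g t)) ->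
  level_comp n x (i e0) -> set_val (q e0) = g t0 ->
  forall t, exists D : set (R * E),
    [/\ connected D, D `<=` [set u | set_val (q u.2) = g u.1 /\ level_comp n x (i u.2)],
        D (t0, e0) & exists e, D (t, e)].
Proof.
move=> cg gn gS xe0 q0 t.
have [g' cg' gE] := @corestrict_continuous _ _ (~` harmonic_points R) g cg gS.
have q0' : q e0 = g' t0 by apply: set_val_inj; rewrite gE q0.
have [D [cD Dq D0 Dt]] := covering_lift covq cg' q0' t.
have Dg u : D u -> set_val (q u.2) = g u.1 by move=> /Dq /= ->; rewrite gE.
exists D; split=> // u Du; split; first exact: Dg.
apply: (connected_component_trans xe0).
exists ((i \o snd) @` D); last by exists u.
split; first by exists (t0, e0).
  by move=> _ [v Dv <-]; rewrite /= pi_q Dg.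
apply: connected_image cD; exact: (continuousT_comp (@snd_continuous R E) ci).
Qed.

(** The trace of a component on E projects onto a nonempty open set, which is not
    contained in the horizontal axis. From a point off the axis, every point off
    the axis on the same side is joined by a segment avoiding the harmonic points. *)
Lemma level_comp_off_axis n x : open_square n (p x) ->
  exists2 e, level_comp n x (i e) & (set_val (q e)).2 != 0.
Proof.
move=> px; have [e xe] := level_comp_meets px.
have oW : open (i @^-1` level_comp n x) by exact: ((continuousP _).1 ci _ (level_comp_open n x)).
have [V oV VE] := covering_open covq oW.
have Ve : V (set_val (q e)).
  suff : (set_val @^-1` V) (q e) by [].
  by rewrite VE; exists e.
have /nbhs_ballP[r /= r0 rV] := open_nbhs_nbhs (conj oV Ve).
set z := set_val (q e) in rV *.
(* move vertically by half the radius when z is on the axis *)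
pose d := if z.2 == 0 then r / 2 else 0.
have Vz' : V (z.1, z.2 + d).
  apply: rV; split; first exact: ballxx.
  rewrite /ball /= opprD addrA subrr sub0r normrN /d.
  by case: ifP => _; rewrite ?normr0// gtr0_norm ?divr_gt0// ltr_pdivrMr// ltr_pMr// ltr1n.
have d0 : z.2 + d != 0.
  rewrite /d; case: ifP => [/eqP -> |/negbT z0]; last by rewrite addr0.
  by rewrite add0r gt_eqF// divr_gt0.
have nS : (~` harmonic_points R) (z.1, z.2 + d).
  by move=> /harmonic_axis/= /eqP; rewrite (negbTE d0).
have [e' xe' qe'] : (q @` (i @^-1` level_comp n x)) (SigSub (mem_set nS)).
  by rewrite -VE /= set_valE.
by exists e' => //; rewrite qe' set_valE.
Qed.

(** The children obtained by winding k times around (1/(n+1), 0), for k in nat. *)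
Lemma level_comp_children n x : open_square n (p x) -> exists h : nat -> X,
  (forall k, level_comp n x (h k) /\ open_square n.+1 (p (h k))) /\
  (forall k l, level_comp n.+1 (h k) = level_comp n.+1 (h l) -> k = l).
Proof.
move=> px; set s : R := n.+1%:R^-1.
(* the vector from q e to (s, 0): on the next square its first coordinate is
   positive, so that the cosine of its angle is positive there *)
pose f e : R * R := (s - (set_val (q e)).1, - (set_val (q e)).2).
have cpos : continuous (fun e => set_val (q e)).
  have -> : (fun e => set_val (q e)) = p \o i by apply/funext => e /=; rewrite pi_q.
  exact: continuousT_comp ci cp.
have cf : continuous f.
  apply: pair_continuous => e.
    apply: cvgB; first exact: cvg_cst.
    exact: (continuousT_comp cpos (@fst_continuous R R)).
  apply: cvgN; exact: (continuousT_comp cpos (@snd_continuous R R)).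
have f0 e : f e <> (0, 0).
  move=> [/eqP]; rewrite subr_eq0 => /eqP s1 /eqP; rewrite oppr_eq0 => /eqP s2.
  have : (~` harmonic_points R) (set_val (q e)) by exact: set_valP.
  apply; left; exists n.+1 => //; rewrite -/s [RHS]surjective_pairing.
  by rewrite s1 s2.
have [theta ctheta thetaE] := global_angle cf f0 sE lE.
have [e0 xe0 y0] := level_comp_off_axis px.
set z := set_val (q e0) in y0.
(* go straight to a point vertically aligned with (s, 0), on the side of z, and
   at a distance less than the gap *)
have rad0 := harmonic_gap_gt0 R n.
pose c := harmonic_gap R n / (1 + `|z.2|).
have y1 : 0 < 1 + `|z.2| by rewrite ltr_pwDl.
have c0 : 0 < c by rewrite divr_gt0.
have cy : c * `|z.2| < harmonic_gap R n.
  rewrite /c mulrAC ltr_pdivrMr// ltr_pM2l//; lra.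
have [e1 xe1 q1] : exists2 e1, level_comp n x (i e1) & set_val (q e1) = (s, c * z.2).
  pose g0 t : R * R := ((1 - clamp t) * z.1 + clamp t * s,
                        (1 - clamp t) * z.2 + clamp t * (c * z.2)).
  have cg0 : continuous g0.
    have lin (a b : R) : continuous (fun t : R => (1 - clamp t) * a + clamp t * b).
      move=> t; apply: cvgD; apply: cvgM; try exact: cvg_cst; last exact: continuous_clamp.
      by apply: cvgB; [exact: cvg_cst|exact: continuous_clamp].
    by apply: pair_continuous; exact: lin.
  have zn : open_square n z by rewrite /z -pi_q; exact: level_comp_sub xe0.
  have wn : open_square n (s, c * z.2).
    apply: (@open_square_disk _ n s (c * z.2) (c * `|z.2|)).
    - by rewrite cy mulr_gt0// normr_gt0.
    - by rewrite subrr normr0 mulr_ge0// ltW.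
    - by rewrite normrM gtr0_norm.
  have gn t : open_square n (g0 t).
    by have := open_square_convex zn wn (clamp_itv t).
  have gS t : ~ harmonic_points R (g0 t).
    move=> /harmonic_axis /= /eqP.
    have -> : (1 - clamp t) * z.2 + clamp t * (c * z.2) =
      ((1 - clamp t) + clamp t * c) * z.2 by ring.
    rewrite mulf_eq0 (negbTE y0) orbF gt_eqF//.
    have /andP[t0 t1] := clamp_itv t.
    have [->|tn1] := eqVneq (clamp t) 1; first by rewrite subrr add0r mul1r.
    rewrite ltr_pwDl//; last by rewrite mulr_ge0// ltW.
    by rewrite subr_gt0 lt_neqAle tn1.
  have q0 : set_val (q e0) = g0 0.
    rewrite /g0 clamp_id ?lexx ?ler01// subr0 !mul1r !mul0r !addr0.
    exact: surjective_pairing.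
  have [D [_ Dq _ [e1 De1]]] := level_comp_lift cg0 gn gS xe0 q0 1.
  have [/= qe1 xe1] := Dq _ De1; exists e1 => //.
  by rewrite qe1 /g0 clamp_id ?lexx ?ler01// subrr !mul1r !mul0r !add0r.
have [r r0 fe1] := thetaE e1.
have rE : r = c * `|z.2|.
  apply/eqP; rewrite -(eqrXn2 (n := 2))//; [|exact: ltW|by rewrite mulr_ge0// ltW].
  rewrite exprMn real_normK ?num_real// -[r ^+ 2]mulr1 -(cos2Dsin2 (theta e1)).
  rewrite mulrDr -!exprMn; move: fe1; rewrite /f q1 /= subrr => -[<- <-].
  by rewrite expr0n add0r sqrrN exprMn.
(* the circle, parametrized so that f e has angle t when q e = g t *)
pose g t : R * R := (s - r * cos t, - (r * sin t)).
have cg : continuous g.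
  apply: pair_continuous => t.
    apply: cvgB; first exact: cvg_cst.
    by apply: cvgM; [exact: cvg_cst|exact: continuous_cos].
  by apply: cvgN; apply: cvgM; [exact: cvg_cst|exact: continuous_sin].
have gdist t : (s - r * cos t - s) ^+ 2 + (- (r * sin t)) ^+ 2 = r ^+ 2.
  rewrite addrAC subrr add0r !sqrrN !exprMn -mulrDr cos2Dsin2; exact: mulr1.
have rn : 0 < r < harmonic_gap R n by rewrite r0 rE.
have gn t : open_square n (g t).
  apply: (open_square_disk rn).
    rewrite addrAC subrr add0r normrN normrM (gtr0_norm r0) ler_piMr ?cos_max//; exact: ltW.
  by rewrite normrN normrM (gtr0_norm r0) ler_piMr ?sin_max//; exact: ltW.
have gS t : ~ harmonic_points R (g t) by exact: harmonic_isolated rn (gdist t).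
have qg1 : set_val (q e1) = g (theta e1).
  rewrite [LHS]surjective_pairing /g; move: fe1; rewrite /f => -[<- <-].
  by rewrite subKr opprK.
have full k : exists e, [/\ level_comp n x (i e), theta e = pi *+ 2 *+ k &
    set_val (q e) = (s - r, 0)].
  have [D [cD Dq D1 [e De]]] := level_comp_lift cg gn gS xe1 qg1 (pi *+ 2 *+ k).
  have [/= qe xe] := Dq _ De.
  have cd : continuous (fun u : R * E => theta u.2 - u.1).
    move=> u; apply: cvgB; last exact: fst_continuous.
    exact: (continuousT_comp (@snd_continuous R E) ctheta).
  have cos1 u : D u -> cos (theta u.2 - u.1) = 1.
    move=> /Dq[qu _]; apply: (@is_angle_cosB _ (f u.2)) => //.
    by exists r => //; rewrite /f qu /g/= subKr opprK.
  have := connected_cos_eq1 cD cd cos1 D1 De.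
  rewrite /= subrr => /eqP; rewrite eq_sym subr_eq0 => /eqP te.
  exists e; split => //; rewrite qe /g -[_ *+ k]add0r.
  by rewrite (periodicn (@cosD2pi R)) (periodicn (@sinD2pi R)) cos0 sin0 mulr1 mulr0 oppr0.
have [e eP] := choice full.
have e_sq k : open_square n.+1 (p (i (e k))).
  have [_ _ qe] := eP k; rewrite pi_q qe; split => /=; last by rewrite normr0 mulr0.
  have rs : r < s by apply: lt_trans (harmonic_gap_lt R n); case/andP: rn.
  rewrite gtr0_norm ?subr_gt0// -ltr_pdivlMl// mulr1 -/s.
  by rewrite gtrBl.
exists (i \o e); split; first by move=> k; have [xe _ qe] := eP k; split=> //=; exact: e_sq.
suff lt k l : (k < l)%N -> level_comp n.+1 (i (e k)) <> level_comp n.+1 (i (e l)).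
  by move=> k l kl; case: (ltngtP k l) => // /lt; case; [exact: kl|exact: esym].
move=> kl Ekl.
have [[_ tk _] [_ tl _]] := (eP k, eP l).
have /connected_intervalP itv :=
  connected_image ctheta (@level_comp_preimage_connected n.+1 (i (e k))).
(* a point of the component where theta is 2 k pi + pi lies on the right of (s, 0) *)
have [e' xe' te'] : (theta @` (i @^-1` level_comp n.+1 (i (e k)))) (pi *+ 2 *+ k + pi).
  apply: (itv (theta (e k)) (theta (e l))).
  - by exists (e k) => //=; apply: connected_component_refl; exact: e_sq.
  - by exists (e l) => //=; rewrite Ekl; apply: connected_component_refl; exact: e_sq.
  - rewrite tk tl lerDl pi_ge0/=; apply: (@le_trans _ _ (pi *+ 2 *+ k.+1)).
      by rewrite [_ *+ k.+1]mulrSr lerD2l mulr2n lerDl pi_ge0.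
    by rewrite ler_wpMn2l// mulrn_wge0// pi_ge0.
have [r' r'0] := thetaE e'.
rewrite te' cosDpi -[_ *+ k]add0r (periodicn (@cosD2pi R)) cos0 mulrN1 => -[sx _].
have [+ _] := level_comp_sub xe'; rewrite pi_q -ltr_pdivlMl// mulr1 -/s => xs.
have := le_lt_trans (ler_norm _) xs; rewrite -subr_gt0 sx oppr_gt0.
by rewrite ltNge (ltW r'0).
Qed.

Lemma level_comp_mono m n x : (m <= n)%N -> open_square n (p x) ->
  level_comp n x `<=` level_comp m x.
Proof.
move=> mn px; have sub : open_square (R := R) n `<=` open_square m.
  elim: n mn {px} => [|n IH]; first by rewrite leqn0 => /eqP ->.
  rewrite leq_eqVlt => /predU1P[-> //|mn].
  exact: subset_trans (@open_square_subset R n) (IH mn).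
apply: connected_component_max; last exact: component_connected.
  exact: connected_component_refl.
by move=> y /level_comp_sub/sub.
Qed.

Lemma total_connected : connected [set: X].
Proof.
have [_ _ _ [_ dn _]] := compl.
have -> : [set: X] = closure (range i).
  apply/seteqP; split => // x _ W; rewrite nbhsE => -[W' [oW' W'x] W'W].
  have [|y [W'y iy]] := dn W' _ oW'; first by exists x.
  by exists y; split => //; exact: W'W.
apply/connected_closure/connected_image => //.
exact: path_connected_connected sE.1.
Qed.

Lemma level_comp0 x : level_comp 0 x = setT.
Proof.
have -> : level_comp 0 x = connected_component setT x by rewrite /level_comp open_square0.
by rewrite connected_component_id//; exact: total_connected.
Qed.

Definition level_comps n := level_comp n @` (p @^-1` open_square n).

Lemma level_compsP n C x : level_comps n C -> C x -> C = level_comp n x.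
Proof. by move=> [y _ <-] yx; exact: same_connected_component. Qed.

Lemma level_comps_comp n x : open_square n (p x) -> level_comps n (level_comp n x).
Proof. by exists x. Qed.

Lemma level_comps_nonempty n C : level_comps n C -> exists2 x, C x & open_square n (p x).
Proof. by move=> [x px <-]; exists x => //; exact: connected_component_refl. Qed.

(** The traces on E of the components are disjoint, open and nonempty. *)
Lemma level_comps_countable n : countable (level_comps n).
Proof.
have cF : countable ((fun C => i @^-1` C) @` level_comps n).
  apply: (covering_countable_open_family covq).
  - exact: path_connected_connected sE.1.
  - exact/second_countable_subtype/plane_second_countable.
  - move=> _ [_ [x px <-] <-]; split; last exact: level_comp_meets.
    exact: ((continuousP _).1 ci _ (level_comp_open n x)).
  - move=> _ _ [C cC <-] [C' cC' <-] [e [/= Ce C'e]].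
    by rewrite (level_compsP cC Ce) (level_compsP cC' C'e).
apply: (@countable_correspondence _ _ _ _ (fun C V => i @^-1` C = V) cF).
  by move=> C cC; exists (i @^-1` C) => //; exists C.
move=> C C' V cC cC' <- VV; have [x px Cx] := cC.
have [e xe] := level_comp_meets px.
have Ce : C (i e) by rewrite -Cx.
have C'e : C' (i e) by have : (i @^-1` C') e by rewrite VV.
by rewrite (level_compsP cC Ce) (level_compsP cC' C'e).
Qed.

Definition children n C := [set C' | level_comps n.+1 C' /\ C' `<=` C].

Lemma children_card n C : level_comps n C -> (children n C #= [set: int])%card.
Proof.
move=> [x px <-]; have [h [hP hinj]] := level_comp_children px.
apply: (@card_eq_trans _ _ _ _ [set: nat]).
  apply: (@countable_infinite_card _ _ (fun k => level_comp n.+1 (h k))) => //.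
  - apply: sub_countable (level_comps_countable n.+1).
    by apply: subset_card_le => C' [].
  - move=> k; have [xk pk] := hP k; split; first exact: level_comps_comp.
    have -> : level_comp n x = level_comp n (h k) by exact: same_connected_component.
    exact: level_comp_mono.
rewrite card_eq_sym; apply: (@countable_infinite_card _ _ Posz) => //.
by move=> a b [].
Qed.

(** An element C of the generating family that contains x is the component of x in
    the preimage of some neighbourhood of the origin, which contains a U_n; then C
    contains the component of x of level n. Finitely many C are handled by taking
    n large. *)
Lemma level_comp_basis x (W : set X) : p x = (0, 0) -> open W -> W x ->
  exists n, level_comp n x `<=` W.
Proof.
move=> px oW Wx.
have [_ [[_ _ _ _ gen] _] _ _] := compl.
have [D DG WD] := (gen W).1 oW.
move: Wx; rewrite WD => -[V DV Vx].
have [D' D'G VE] := DG _ DV.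
have VxD' := Vx; rewrite -VE in VxD'.
have : \oo [set n | level_comp n x `<=` V].
  have near := @filter_bigI nat _ D' (fun C : set X => [set n | level_comp n x `<=` C]) \oo _.
  apply: filterS (near _ _) => [n nV y xy|C CD'].
    by rewrite -VE => C CD'; exact: nV xy.
  have := D'G _ CD'; rewrite inE => -[U oU [y py CE]].
  have Cx : C x := VxD' _ CD'; have Ux : U (0, 0).
    by rewrite -px; rewrite -CE in Cx; exact: connected_component_sub Cx.
  have [n nU] := open_square_nbhs (open_nbhs_nbhs (conj oU Ux)).
  exists n => // m /= nm; have pn k : open_square k (p x) by rewrite px; exact: open_square_center.
  apply: (subset_trans (level_comp_mono nm (pn m))).
  rewrite -CE in Cx *; rewrite (same_connected_component Cx).
  apply: connected_component_max; last exact: component_connected.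
    by apply: connected_component_refl; exact: pn.
  by move=> z /level_comp_sub/nU.
by move=> [n _ /(_ n (leqnn n)) nV]; exists n => y xy; exists V => //; exact: nV.
Qed.

Lemma level_comp_separates x y : p x = (0, 0) -> p y = (0, 0) ->
  (forall n, level_comp n x = level_comp n y) -> x = y.
Proof.
move=> px py xy; have [_ [[[hX _] _ _ _ _] _] _ _] := compl.
apply: hX => A B; rewrite !nbhsE => -[A' [oA' A'x] A'A] [B' [oB' B'y] B'B].
have [n nA] := level_comp_basis px oA' A'x; have [m mB] := level_comp_basis py oB' B'y.
have pn k : open_square k (p x) by rewrite px; exact: open_square_center.
exists x; split.
  by apply/A'A/nA; exact: level_comp_refl.
by apply/B'B/mB; rewrite -xy; exact: level_comp_refl.
Qed.

(** The sequence C extends to all the connected neighbourhoods U of the origin: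
    chi U is the component of the preimage of U that contains C n for all the n
    with U_n inside U. Completeness then provides the point. *)
Lemma thread_point (C : nat -> set X) : (forall n, level_comps n (C n)) ->
  (forall n, C n.+1 `<=` C n) -> exists x, p x = (0, 0) /\ forall n, C n x.
Proof.
move=> cC CS; have Cm m n : (m <= n)%N -> C n `<=` C m.
  elim: n => [|n IH]; first by rewrite leqn0 => /eqP ->.
  rewrite leq_eqVlt => /predU1P[-> //|mn].
  exact: subset_trans (CS n) (IH mn).
have /choice[c cP] n : exists x, C n x /\ open_square n (p x).
  by have [x Cx px] := level_comps_nonempty (cC n); exists x.
have /choice[N NP] (U : set (R * R)) : exists n,
    open_connected_nbhs (0, 0) U -> open_square n `<=` U.
  have [[oU _ U0]|] := pselect (open_connected_nbhs (0, 0) U); last by exists 0%N.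
  by have [n nU] := open_square_nbhs (open_nbhs_nbhs (conj oU U0)); exists n.
have Cconn n U : open_square n `<=` U -> forall x y, C n x -> C n y ->
    connected_component (p @^-1` U) x y.
  move=> nU x y Cx Cy; exists (C n) => //; split => //.
    by rewrite (level_compsP (cC n) Cx) => z /level_comp_sub/nU.
  by rewrite (level_compsP (cC n) Cx); exact: component_connected.
pose chi U := connected_component (p @^-1` U) (c (N U)).
have chiC U n : open_connected_nbhs (0, 0) U -> open_square n `<=` U -> C n `<=` chi U.
  move=> hU nU x Cx.
  have Cc k : (k <= maxn n (N U))%N -> C k (c (maxn n (N U))).
    by move=> /Cm; apply; exact: (cP _).1.
  apply: (@connected_component_trans _ _ (c (maxn n (N U)))).
    by apply: (Cconn (N U)); [exact: NP|exact: (cP _).1|apply: Cc; exact: leq_maxr].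
  by apply: (Cconn n) => //; apply: Cc; exact: leq_maxl.
have [_ [_ cpl] _ _] := compl.
have [|U hU|U V hU hV UV|x xchi] := cpl (0, 0) _ chi.
- move=> W /open_square_nbhs[n nW]; exists (p (c n)); split; first by exists (c n).
  by apply: nW; exact: (cP _).2.
- exists (c (N U)) => //=; apply: NP => //; exact: (cP _).2.
- have cV : chi V (c (N U)).
    apply: (chiC V (N U)) => //; last exact: (cP _).1.
    exact: subset_trans (NP U hU) UV.
  rewrite /chi (same_connected_component cV).
  apply: connected_component_max; last exact: component_connected.
    by apply: connected_component_refl; apply: NP => //; exact: (cP _).2.
  by move=> z /connected_component_sub/UV.
have Cx n : C n x.
  have chix := xchi _ (open_square_connected_nbhs R n).
  have chic : chi (open_square n) (c n).
    by apply: (chiC _ n) => //; [exact: open_square_connected_nbhs|exact: (cP _).1].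
  rewrite (level_compsP (cC n) (cP n).1) /level_comp -(same_connected_component chic).
  exact: chix.
exists x; split => //.
have px n : open_square n (p x).
  by have := Cx n; rewrite (level_compsP (cC n) (Cx n)) => /level_comp_sub.
have hRR : hausdorff_space (R * R)%type by have [[[_ ?] _ _ _ _] _ _ _] := compl.
apply: esym; apply: hRR => A B /open_square_nbhs[n nA] /nbhs_singleton Bx.
by exists (p x); split => //; exact: nA.
Qed.

(** * The fiber above the origin *)

Local Notation fiber := (p @^-1` [set (0, 0)]).
Local Notation seqZ := {ptws nat -> discrete_topology int}.

Lemma fiber_val (x : fiber) : p (set_val x) = (0, 0).
Proof. by have := set_valP x. Qed.

Lemma fiber_nbhs (x : fiber) (W : set X) :
  open W -> W (set_val x) -> nbhs x (set_val @^-1` W : set fiber).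
Proof. by move=> oW Wx; exists (set_val @^-1` W) => //; split => //; exists W. Qed.

(** [F x] lists the labels of the successive components of x, [G a] is the point of
    the branch that follows the labels a. The last two properties are the
    continuity of F and of G, in terms of components. *)
Lemma fiber_coding : exists (F : fiber -> seqZ) (G : seqZ -> fiber),
  [/\ cancel F G, cancel G F,
      (forall n x y, level_comp n.+1 (set_val x) = level_comp n.+1 (set_val y) -> F x n = F y n) &
      forall n a b, (forall k, (k < n)%N -> a k = b k) ->
        level_comp n (set_val (G a)) = level_comp n (set_val (G b))].
Proof.
have /choice[next nextP] (u : nat * set X) : exists f : int -> set X,
    level_comps u.1 u.2 -> set_bij setT (children u.1 u.2) f.
  have [cu|ncu] := pselect (level_comps u.1 u.2); last by exists (fun=> set0).
  have := children_card cu; rewrite card_eq_sym => cu'.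
  by have [f fP] := card_set_bijP cu'; exists f.
have /choice[code codeP] (v : nat * set X * set X) : exists z, level_comps v.1.1 v.1.2 ->
    children v.1.1 v.1.2 v.2 -> next v.1 z = v.2.
  have [[cv chv]|nv] := pselect (level_comps v.1.1 v.1.2 /\ children v.1.1 v.1.2 v.2).
    by have [_ _ /(_ _ chv)[z _ zv]] := nextP v.1 cv; exists z.
  by exists 0 => cv chv; case: nv.
have [x0 px0] : exists x0, open_square 0 (p x0).
  have [_ qT _] := covq.
  have nS : (~` harmonic_points R) (0, 1).
    by move=> /harmonic_axis/= /eqP; rewrite oner_eq0.
  have [e _ _] : range q (SigSub (mem_set nS)) by rewrite qT.
  by exists (i e); rewrite open_square0.
(* the branch that follows a, starting at the component X of level 0 *)
pose th (a : nat -> int) := fix th n := if n is k.+1 then next (k, th k) (a k) else setT.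
have thC a n : level_comps n (th a n).
  elim: n => [|n IH] /=; first by exists x0 => //; exact: level_comp0.
  by have [/(_ (a n) I)[]] := nextP (n, th a n) IH.
have thch a n : children n (th a n) (th a n.+1).
  by have [/(_ (a n) I)] := nextP (n, th a n) (thC a n).
have thcode a n : code (n, th a n, th a n.+1) = a n.
  have [_ inj _] := nextP (n, th a n) (thC a n).
  by apply: inj; rewrite ?inE//; exact: (codeP (n, th a n, th a n.+1) (thC a n) (thch a n)).
have th_agree n a b : (forall k, (k < n)%N -> a k = b k) -> th a n = th b n.
  elim: n => [//|n IH] ab /=.
  by rewrite (ab n)// IH// => k kn; apply: ab; rewrite leqW.
have thpoint a : exists x : fiber, forall n, level_comp n (set_val x) = th a n.
  have [x [px xC]] := thread_point (thC a) (fun n => (thch a n).2).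
  exists (SigSub (mem_set (px : fiber x))) => n.
  by rewrite (level_compsP (thC a n) (xC n)) set_valE.
have [G GP] := choice thpoint.
pose F (x : fiber) : seqZ :=
  fun n => code (n, level_comp n (set_val x), level_comp n.+1 (set_val x)).
have thF (x : fiber) n : th (F x) n = level_comp n (set_val x).
  have px k : open_square k (p (set_val x)) by rewrite fiber_val; exact: open_square_center.
  elim: n => [|n IH]; first by rewrite level_comp0.
  rewrite /= IH; apply: (codeP (n, _, _)) => /=; first exact: level_comps_comp.
  by split; [exact: level_comps_comp|exact: level_comp_mono].
exists F, G; split.
- move=> x; apply: set_val_inj; apply: level_comp_separates; rewrite ?fiber_val// => n.
  by rewrite GP thF.
- by move=> a; apply/funext => n; rewrite /F !GP thcode.
- move=> n x y xy; rewrite /F xy; congr (code (n, _, _)).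
  have px k z : open_square k (p (@set_val _ fiber z)).
    by rewrite fiber_val; exact: open_square_center.
  apply: same_connected_component; apply: (level_comp_mono (leqnSn n) (px n.+1 x)).
  by rewrite xy; apply: level_comp_refl; exact: px.
- by move=> n a b ab; rewrite !GP (th_agree n a b).
Qed.

Lemma seqZ_nbhs (a : seqZ) n : nbhs a [set b | forall k, (k < n)%N -> a k = b k].
Proof.
have FF : Filter (nbhs a) by exact: nbhs_filter.
elim: n => [|n IH]; first by apply: filterS filterT => b _ k.
have an : nbhs a [set b : seqZ | b n = a n].
  have := @proj_continuous nat (fun=> discrete_topology int) n a [set a n].
  by apply; exact: discrete_set1.
apply: filterS (filterI IH an) => b [/= IHb bn] k.
by rewrite ltnS leq_eqVlt => /predU1P[->//|/IHb].
Qed.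

Lemma fiber_homeomorphic : homeomorphic fiber seqZ /\ ~ locally_compact [set: fiber].
Proof.
have [F [G [FG GF Floc Gloc]]] := fiber_coding.
have sqx k (z : fiber) : open_square k (p (set_val z)).
  by rewrite fiber_val; exact: open_square_center.
have refl k (z : fiber) : level_comp k (set_val z) (set_val z) by exact: level_comp_refl.
have Fnear (x : fiber) n : \forall y \near x, F y n = F x n.
  apply: filterS (fiber_nbhs (level_comp_open n.+1 (set_val x)) (refl _ _)) => y /= xy.
  by apply: Floc; rewrite /level_comp (same_connected_component xy).
split.
  exists F, G; split => //.
    move=> x; have FF : Filter (F @ nbhs x) by exact: fmap_filter.
    apply/cvg_sup => n U [V [[W oW <-] Wx WU]]; apply: (filterS WU).
    by apply: filterS (Fnear x n) => y yx; rewrite /preimage /= yx.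
  move=> a W [W' [[V oV <-] Va] VW].
  have [n nV] := level_comp_basis (fiber_val (G a)) oV Va.
  apply: (@filterS _ _ (nbhs_filter (a : seqZ)) _ _ _ (seqZ_nbhs a n)) => b ab; apply: VW => /=.
  by apply: nV; rewrite (Gloc n a b ab).
(* in a neighbourhood K of x0 the coordinate of some index n takes all values,
   because K contains the branches that agree with that of x0 below n *)
pose x0 := G (fun=> 0).
move=> /(_ x0 I)[K nK [cK _]].
have {}nK : nbhs x0 K by move: nK; rewrite /within /=;
  apply: filterS => x; apply.
have [W' [[V oV <-] Va] VK] := nK.
have [n nV] := level_comp_basis (fiber_val x0) oV Va.
(* all natural numbers are taken as absolute values, which already rules out
   compactness *)
pose f (x : fiber) : nat := absz (F x n).
have cf : continuous f.
  move=> x U /nbhs_singleton Ux.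
  by apply: filterS (Fnear x n) => y yx; rewrite /preimage/= /f yx.
have : compact (f @` K) by apply: continuous_compact cK; exact: continuous_subspaceT.
have -> : f @` K = setT.
  apply/seteqP; split => // z _.
  pose a k : int := if k == n then Posz z else F x0 k.
  exists (G a); last by rewrite /f GF /a eqxx.
  apply: VK; apply: nV; rewrite -[x0]FG (Gloc n (F x0) a) => [|k kn].
    exact: refl.
  by rewrite /a ltn_eqF.
rewrite compact_cover => /(_ _ setT (fun z => [set z]))[||D _ DT].
- by move=> z _; exact: discrete_open.
- by move=> z _; exists z.
apply: infinite_nat; apply: (sub_finite_set _ (finite_fset D)) => z _.
by have [y Dy ->] := DT z I.
Qed.

End Branched.

Unset Implicit Arguments.

Theorem mainTheorem9 (R : realType) (X : topologicalType) (p : X -> R * R)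
    (hp : is_branched_universal_covering R (harmonic_points R) p) :
  homeomorphic (p @^-1` [set (0, 0)]) {ptws nat -> discrete_topology int} /\
  ~ locally_compact [set: p @^-1` [set (0, 0)]].
Proof.
have [E [q [i [[covq sE] compl]]]] := hp.
exact: (fiber_homeomorphic covq sE compl).
Qed.
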